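(* Let $(R,m)$ be a noetherian local ring with infinite residue field $R/m$. Let $R\to S$ be a flat morphism (i.e. a flat ring homomorphism). Suppose that $P^\bullet$ and $Q^\bullet$ are strictly perfect complexes over $R$. If there is a quasi-isomorphism $P^\bullet\otimes_R S\cong Q^\bullet\otimes_R S$, then there is a quasi-isomorphism $P^\bullet\cong Q^\bullet$.
   Context: A strictly perfect complex over $R$ is a bounded complex of finitely generated projective $R$-modules. A quasi-isomorphism between two complexes here means an isomorphism between them in the derived category.
   Formalization: ''Flat'' is strengthened to ''faithfully flat'': for merely flat R→S the claim fails, e.g. R=k[t]_(t), S=Frac R, P=(t:R→R), Q=0; for flat R→S with mS=S it always fails for a Koszul complex. *)

(* Defs.v *)
From HB Require Import structures.
From mathcomp Require Import all_boot all_order all_algebra.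
From mathcomp Require Import boolp classical_sets functions cardinality.

Set Implicit Arguments.
Unset Strict Implicit.
Unset Printing Implicit Defensive.

Import GRing.Theory.
Local Open Scope ring_scope.
Local Open Scope quotient_scope.

Section Ideals.
Variable R : comNzRingType.

Definition is_ideal (I : set R) : Prop :=
  [/\ I 0, forall x y, I x -> I y -> I (x + y)
    & forall a x, I x -> I (a * x)].

Definition noetherian : Prop :=
  forall I : set R, is_ideal I ->
    exists (n : nat) (g : 'I_n -> R),
      forall x, I x <-> exists c : 'I_n -> R, x = \sum_(i < n) c i * g i.

Definition is_maximal_ideal (m : set R) : Prop :=
  [/\ is_ideal m, ~ m 1
    & forall J : set R, is_ideal J -> ~ J 1 ->
        (m `<=` J)%classic -> J = m].

Definition local_ring (m : set R) : Prop :=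
  is_maximal_ideal m /\ forall m' : set R, is_maximal_ideal m' -> m' = m.

(* The set of cosets x + I, i.e. the underlying set of R / I. *)
Definition cosets (I : set R) : set (set R) :=
  range (fun x : R => [set y | I (y - x)]%classic).

End Ideals.

Section Tensor.
Variables (R S : comPzRingType) (phi : {rmorphism R -> S}).

Section Module.
Variable M : lmodType R.

(* A sequence [:: (x1, s1); ...; (xn, sn)] stands for the formal sum
   x1 (x) s1 + ... + xn (x) sn; M (x)_R S is the free commutative monoid on
   M * S modulo the congruence generated by the bilinearity relations.  The
   relation 0 (x) 0 = 0 has to be imposed because we start from a monoid. *)
Inductive tens_eq : seq (M * S) -> seq (M * S) -> Prop :=
| tens_refl u : tens_eq u u
| tens_sym u v : tens_eq u v -> tens_eq v u
| tens_trans u v w : tens_eq u v -> tens_eq v w -> tens_eq u w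
| tens_cat u u' v v' :
    tens_eq u u' -> tens_eq v v' -> tens_eq (u ++ v) (u' ++ v')
| tens_catC u v : tens_eq (u ++ v) (v ++ u)
| tens_0 : tens_eq [:: (0, 0)] [::]
| tens_Dl x y s : tens_eq [:: (x + y, s)] [:: (x, s); (y, s)]
| tens_Dr x s t : tens_eq [:: (x, s + t)] [:: (x, s); (x, t)]
| tens_Z a x s : tens_eq [:: (a *: x, s)] [:: (x, phi a * s)].

Definition tens_eqb : rel (seq (M * S)) := fun u v => `[< tens_eq u v >].

Lemma tens_eqb_refl : reflexive tens_eqb.
Proof. by move=> u; apply/asboolP; constructor. Qed.

Lemma tens_eqb_sym : symmetric tens_eqb.
Proof.
by move=> u v; apply/idP/idP => /asboolP h; apply/asboolP; apply: tens_sym.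
Qed.

Lemma tens_eqb_trans : transitive tens_eqb.
Proof.
move=> v u w /asboolP uv /asboolP vw; apply/asboolP.
exact: tens_trans uv vw.
Qed.

Canonical tens_equiv :=
  EquivRel tens_eqb tens_eqb_refl tens_eqb_sym tens_eqb_trans.

Definition tensor := {eq_quot tens_equiv}.
HB.instance Definition _ := Choice.on tensor.

Definition tpi (u : seq (M * S)) : tensor := \pi_({eq_quot tens_equiv}) u.
Definition trepr (z : tensor) : seq (M * S) := @repr _ {eq_quot tens_equiv} z.

Lemma treprK z : tpi (trepr z) = z.
Proof. exact: reprK. Qed.

Lemma tpiP u v : tpi u = tpi v <-> tens_eq u v.
Proof.
split=> [/eqmodP/asboolP //|h].
by apply/eqmodP/asboolP.
Qed.

Lemma trepr_pi u : tens_eq (trepr (tpi u)) u.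
Proof. by apply/tpiP; rewrite treprK. Qed.

Definition pure_tensor (x : M) (s : S) : tensor := tpi [:: (x, s)].

Lemma tens_0r x : tens_eq [:: (x, 0)] [::].
Proof.
rewrite -(mulr0 (phi 0)); apply: tens_trans (tens_sym (tens_Z 0 x 0)) _.
by rewrite scale0r; exact: tens_0.
Qed.

Lemma tens_0l s : tens_eq [:: (0, s)] [::].
Proof.
rewrite -(scale0r 0); apply: tens_trans (tens_Z 0 0 s) _.
by rewrite rmorph0 mul0r; exact: tens_0.
Qed.

Definition sc (t : S) (u : seq (M * S)) : seq (M * S) :=
  [seq (p.1, t * p.2) | p <- u].

Lemma tens_sc t u v : tens_eq u v -> tens_eq (sc t u) (sc t v).
Proof.
elim=> {u v} [u|u v _|u v w _ uv _|u u' v v' _ uu _|u v||x y s|x s s'|a x s].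
- exact: tens_refl.
- exact: tens_sym.
- exact: tens_trans.
- by rewrite /sc !map_cat; apply: tens_cat.
- by rewrite /sc !map_cat; apply: tens_catC.
- by rewrite /sc /= mulr0; exact: tens_0.
- exact: tens_Dl.
- by rewrite /sc /= mulrDr; exact: tens_Dr.
- by rewrite /sc /= mulrCA; exact: tens_Z.
Qed.

Lemma tens_scD t t' u : tens_eq (sc (t + t') u) (sc t u ++ sc t' u).
Proof.
elim: u => [|p u IHu] /=; first exact: tens_refl.
rewrite mulrDl -cat1s -[X in tens_eq _ X]cat1s.
apply: tens_trans (tens_cat (tens_Dr _ _ _) IHu) _.
rewrite -[[:: _; _]]cat1s -!catA; apply: tens_cat; first exact: tens_refl.
rewrite catA -[X in tens_eq _ (_ ++ X)]cat1s [X in tens_eq _ X]catA.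
apply: tens_cat; last exact: tens_refl.
exact: tens_catC.
Qed.

Lemma tens_sc0 u : tens_eq (sc 0 u) [::].
Proof.
elim: u => [|p u IHu] /=; first exact: tens_refl.
rewrite mul0r -cat1s -[X in tens_eq _ X]cat0s.
by apply: tens_cat => //; exact: tens_0r.
Qed.

Lemma sc1 u : sc 1 u = u.
Proof. by rewrite /sc -[RHS]map_id; apply: eq_map => -[x s] /=; rewrite mul1r. Qed.

Lemma scA t t' u : sc t (sc t' u) = sc (t * t') u.
Proof.
by rewrite /sc -map_comp; apply: eq_map => -[x s] /=; rewrite mulrA.
Qed.

Definition tens_add (y z : tensor) : tensor := tpi (trepr y ++ trepr z).
Definition tens_scale (t : S) (z : tensor) : tensor := tpi (sc t (trepr z)).

Lemma tens_addE u v : tens_add (tpi u) (tpi v) = tpi (u ++ v).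
Proof. by apply/tpiP; apply: tens_cat; exact: trepr_pi. Qed.

Lemma tens_scaleE t u : tens_scale t (tpi u) = tpi (sc t u).
Proof. by apply/tpiP; apply: tens_sc; exact: trepr_pi. Qed.

Lemma tens_addA : associative tens_add.
Proof.
move=> x y z; rewrite -(treprK x) -(treprK y) -(treprK z).
by rewrite !tens_addE catA.
Qed.

Lemma tens_addC : commutative tens_add.
Proof.
move=> x y; rewrite -(treprK x) -(treprK y) !tens_addE.
by apply/tpiP; exact: tens_catC.
Qed.

Lemma tens_add0 : left_id (tpi [::]) tens_add.
Proof. by move=> x; rewrite -(treprK x) tens_addE. Qed.

Lemma tens_addN : left_inverse (tpi [::]) (tens_scale (-1)) tens_add.
Proof.
move=> x; rewrite -(treprK x) tens_scaleE tens_addE.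
rewrite -[X in _ ++ X]sc1; apply/tpiP.
apply: tens_trans (tens_sym (tens_scD _ _ _)) _.
by rewrite addNr; exact: tens_sc0.
Qed.

HB.instance Definition _ :=
  GRing.isZmodule.Build tensor tens_addA tens_addC tens_add0 tens_addN.

Lemma tens_scaleA a b z : tens_scale a (tens_scale b z) = tens_scale (a * b) z.
Proof. by rewrite -(treprK z) !tens_scaleE scA. Qed.

Lemma tens_scale1 : left_id 1 tens_scale.
Proof. by move=> z; rewrite -(treprK z) tens_scaleE sc1. Qed.

Lemma tens_scaleDr : right_distributive tens_scale +%R.
Proof.
move=> a y z; rewrite -(treprK y) -(treprK z).
rewrite [_ + _]tens_addE !tens_scaleE [RHS]tens_addE.
by rewrite /sc map_cat.
Qed.

Lemma tens_scaleDl z : {morph tens_scale^~ z : a b / a + b}.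
Proof.
move=> a b; rewrite -(treprK z) !tens_scaleE [RHS]tens_addE.
by apply/tpiP; exact: tens_scD.
Qed.

HB.instance Definition _ :=
  GRing.Zmodule_isLmodule.Build S tensor
    tens_scaleA tens_scale1 tens_scaleDr tens_scaleDl.

End Module.

Section Map.
Variables (M N : lmodType R) (f : {linear M -> N}).

Definition mapl (u : seq (M * S)) : seq (N * S) := [seq (f p.1, p.2) | p <- u].

Lemma tens_mapl u v : tens_eq u v -> tens_eq (mapl u) (mapl v).
Proof.
elim=> {u v} [u|u v _|u v w _ uv _|u u' v v' _ uu _|u v||x y s|x s s'|a x s].
- exact: tens_refl.
- exact: tens_sym.
- exact: tens_trans.
- by rewrite /mapl !map_cat; apply: tens_cat.
- by rewrite /mapl !map_cat; apply: tens_catC.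
- by rewrite /mapl /= linear0; exact: tens_0.
- by rewrite /mapl /= linearD; exact: tens_Dl.
- exact: tens_Dr.
- by rewrite /mapl /= linearZ; exact: tens_Z.
Qed.

Definition tensor_map (z : tensor M) : tensor N := tpi (mapl (trepr z)).

Lemma tensor_mapE u : tensor_map (tpi u) = tpi (mapl u).
Proof. by apply/tpiP; apply: tens_mapl; exact: trepr_pi. Qed.

Lemma tensor_map_pure x s : tensor_map (pure_tensor x s) = pure_tensor (f x) s.
Proof. exact: tensor_mapE. Qed.

Lemma tensor_map_linear : linear tensor_map.
Proof.
move=> a y z; rewrite -(treprK y) -(treprK z).
rewrite [a *: _]tens_scaleE [_ + _]tens_addE !tensor_mapE.
rewrite [a *: _]tens_scaleE [RHS]tens_addE.
by rewrite /mapl /sc map_cat -!map_comp.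
Qed.

HB.instance Definition _ :=
  GRing.isLinear.Build S (tensor M) (tensor N) _ tensor_map tensor_map_linear.

End Map.

Definition exact_at (A : pzRingType) (L M N : lmodType A)
    (f : L -> M) (g : M -> N) : Prop :=
  forall y, g y = 0 <-> exists x, f x = y.

Definition flat : Prop :=
  forall (L M N : lmodType R) (f : {linear L -> M}) (g : {linear M -> N}),
    exact_at f g -> exact_at (tensor_map f) (tensor_map g).

(* Flatness alone does not suffice to descend isomorphisms of perfect
   complexes: over a discrete valuation ring R with uniformizer t and fraction
   field K, the complex (t : R -> R) is not acyclic, but it becomes so after
   the flat base change R -> K. *)
Definition faithfully_flat : Prop :=
  flat /\ forall M : lmodType R,
            (forall z : tensor M, z = 0) -> forall x : M, x = 0.

End Tensor.

Arguments tensor_map {R S} phi {M N} f z.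

Section Complexes.
Variable R : pzRingType.

Record complex := Complex {
  cobj :> int -> lmodType R;
  cdiff : forall i, {linear cobj i -> cobj (i + 1)};
  cdiffK : forall i x, cdiff (i + 1) (cdiff i x) = 0
}.

Record cmap (X Y : complex) := Cmap {
  cfun :> forall i, {linear X i -> Y i};
  cfunP : forall i x, cfun (i + 1) (cdiff X i x) = cdiff Y i (cfun i x)
}.

Definition cpx_cycle (X : complex) (i : int) (x : X i) : Prop := cdiff X i x = 0.

(* Boundaries are only defined in degrees of the form i + 1, which is every
   degree of a complex indexed by the integers. *)
Definition cpx_boundary (X : complex) (i : int) (x : X (i + 1)) : Prop :=
  exists y : X i, cdiff X i y = x.

(* H^(i+1)(f) is injective and surjective for every i. *)
Definition quasi_iso (X Y : complex) (f : cmap X Y) : Prop :=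
  forall i : int,
    (forall x : X (i + 1), cpx_cycle x -> cpx_boundary (f (i + 1) x) -> cpx_boundary x) /\
    (forall y : Y (i + 1), cpx_cycle y ->
       exists2 x : X (i + 1), cpx_cycle x & cpx_boundary (f (i + 1) x - y)).

(* The derived category D(R), as the localization of the category of complexes
   at the quasi-isomorphisms: morphisms are words composed of chain maps and
   formal inverses of quasi-isomorphisms (written in diagrammatic order),
   modulo the congruence dpath_eq. *)
Inductive dpath : complex -> complex -> Type :=
| dnil X : dpath X X
| dfwd X Y Z (f : cmap X Y) (p : dpath Y Z) : dpath X Z
| dbwd X Y Z (w : cmap Y X) (hw : quasi_iso w) (p : dpath Y Z) : dpath X Z.

Fixpoint dcat (X Y Z : complex) (p : dpath X Y) : dpath Y Z -> dpath X Z :=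
  match p with
  | dnil _ => fun q => q
  | dfwd _ _ _ f p' => fun q => dfwd f (dcat p' q)
  | dbwd _ _ _ _ hw p' => fun q => dbwd hw (dcat p' q)
  end.

Inductive dpath_eq : forall X Y, dpath X Y -> dpath X Y -> Prop :=
| deq_refl X Y (p : dpath X Y) : dpath_eq p p
| deq_sym X Y (p q : dpath X Y) : dpath_eq p q -> dpath_eq q p
| deq_trans X Y (p q r : dpath X Y) :
    dpath_eq p q -> dpath_eq q r -> dpath_eq p r
| deq_fwd X Y Z (f : cmap X Y) (p q : dpath Y Z) :
    dpath_eq p q -> dpath_eq (dfwd f p) (dfwd f q)
| deq_bwd X Y Z (w : cmap Y X) (hw : quasi_iso w) (p q : dpath Y Z) :
    dpath_eq p q -> dpath_eq (dbwd hw p) (dbwd hw q)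
| deq_id X Y (e : cmap X X) (p : dpath X Y) :
    (forall i x, e i x = x) -> dpath_eq (dfwd e p) p
| deq_comp X Y Z T (f : cmap X Y) (g : cmap Y Z) (h : cmap X Z)
    (p : dpath Z T) :
    (forall i x, h i x = g i (f i x)) ->
    dpath_eq (dfwd f (dfwd g p)) (dfwd h p)
| deq_fwd_bwd X Y Z (w : cmap X Y) (hw : quasi_iso w) (p : dpath X Z) :
    dpath_eq (dfwd w (dbwd hw p)) p
| deq_bwd_fwd X Y Z (w : cmap X Y) (hw : quasi_iso w) (p : dpath Y Z) :
    dpath_eq (dbwd hw (dfwd w p)) p.

Definition derived_iso (X Y : complex) : Prop :=
  exists (f : dpath X Y) (g : dpath Y X),
    dpath_eq (dcat f g) (dnil X) /\ dpath_eq (dcat g f) (dnil Y).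

Definition fin_gen (M : lmodType R) : Prop :=
  exists (n : nat) (v : 'I_n -> M),
    forall x, exists c : 'I_n -> R, x = \sum_(i < n) c i *: v i.

Definition projective (M : lmodType R) : Prop :=
  forall (A B : lmodType R) (g : {linear A -> B}) (f : {linear M -> B}),
    (forall b, exists a, g a = b) ->
    exists h : {linear M -> A}, forall x, g (h x) = f x.

Definition bounded (X : complex) : Prop :=
  exists n : nat, forall i : int, (n < `|i|)%N -> forall x : X i, x = 0.

Definition strictly_perfect (X : complex) : Prop :=
  bounded X /\ forall i : int, fin_gen (X i) /\ projective (X i).

End Complexes.

Section BaseChange.
Variables (R S : comPzRingType) (phi : {rmorphism R -> S}) (X : complex R).

Definition bc_obj (i : int) : lmodType S := tensor phi (X i).

Definition bc_diff (i : int) : {linear bc_obj i -> bc_obj (i + 1)} :=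
  tensor_map phi (cdiff X i).

Lemma bc_diffK i z : bc_diff (i + 1) (bc_diff i z) = 0.
Proof.
rewrite -(treprK z) /bc_diff /= !tensor_mapE /mapl -map_comp.
apply/tpiP; elim: (trepr z) => [|[x s] u IHu] /=; first exact: tens_refl.
rewrite cdiffK -cat1s.
apply: tens_trans (tens_cat (tens_refl _ _) IHu) _.
exact: tens_0l.
Qed.

Definition base_change : complex S := Complex bc_diffK.

End BaseChange.

(* Main.v *)
(* As P_S and Q_S are bounded complexes of projectives, their isomorphism in D(S) is
   given by chain maps f, g inverse to each other up to homotopies h, h'; then
   u = gf - (dh + hd) and v = fg - (dh' + h'd) are both the identity.  Being a
   chain map is a linear condition over R, so by the equational criterion of
   flatness (f, g, h, h') is an S-combination of finitely many solutions over R.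
   The determinants of u and v are polynomials over R in the coefficients of that
   combination, and their product takes the value 1 at a point of S^k.  Since
   1 is not in mS and R/m is infinite, this product is not in m at some point of
   R^k.  There u and v are invertible and homotopic to gf and fg, so the
   corresponding f : P -> Q is a quasi-isomorphism. *)
Require Import Defs.
From HB Require Import structures.
From mathcomp Require Import all_boot all_order all_algebra.
From mathcomp Require Import boolp classical_sets functions cardinality.
From mathcomp Require Import zify.

Local Open Scope ring_scope.

Set Implicit Arguments.
Unset Strict Implicit.
Unset Printing Implicit Defensive.

Import GRing.Theory Num.Theory.

(** * Tensor products and framed modules *)

(** A projective module carries no determinant of its own matrices, so all objects are made summands
    of free modules of one common rank. The identity then becomes an idempotent [E], and adding
    [1 - E] to an endomorphism of the summand gives a square matrix whose determinant detects
    invertibility. Invertibility of u and v is what gets descended, because the equations saying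
    that f and g are inverse up to homotopy are quadratic in the unknowns and escape the equational
    criterion. The ring [S/mS] may have zero divisors, so zeros of polynomials cannot be counted in
    it as in a field. What saves the count is that representatives of distinct residues differ by
    units of [R]: a polynomial function can be divided by one linear factor after another. Chain
    maps are extracted from an isomorphism of the localized category by a Yoneda argument: words act
    on homotopy classes of maps out of a bounded complex of projectives, and the action on identity
    maps yields the homotopy equivalence. *)

Section TensorLift.
Variables (R S : comPzRingType) (phi : {rmorphism R -> S}).
Variable M : lmodType R.

Lemma tpi_cons (x : M) s u : tpi phi ((x, s) :: u) = pure_tensor phi x s + tpi phi u.
Proof. by rewrite [RHS]tens_addE. Qed.

Lemma pure_tensor_scale (x : M) s : pure_tensor phi x s = s *: pure_tensor phi x 1.
Proof. by rewrite [RHS]tens_scaleE /sc /= mulr1. Qed.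

Lemma pure_tensorZ a (x : M) s :
  pure_tensor phi (a *: x) s = pure_tensor phi x (phi a * s).
Proof. by apply/tpiP; apply: tens_Z. Qed.

Lemma pure_tensorD (x y : M) s :
  pure_tensor phi (x + y) s = pure_tensor phi x s + pure_tensor phi y s.
Proof. by rewrite -tpi_cons; apply/tpiP; apply: tens_Dl. Qed.

Lemma pure_tensorDr (x : M) s t :
  pure_tensor phi x (s + t) = pure_tensor phi x s + pure_tensor phi x t.
Proof. by rewrite -tpi_cons; apply/tpiP; apply: tens_Dr. Qed.

Lemma pure_tensor0r (x : M) : pure_tensor phi x 0 = 0.
Proof. by apply/tpiP; apply: tens_0r. Qed.

Lemma pure_tensor0l s : pure_tensor phi (0 : M) s = 0.
Proof. by apply/tpiP; apply: tens_0l. Qed.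

Lemma pure_tensor_sumr (I : Type) (r : seq I) (s : I -> S) (x : M) :
  pure_tensor phi x (\sum_(i <- r) s i) = \sum_(i <- r) pure_tensor phi x (s i).
Proof.
elim: r => [|i r IHr]; first by rewrite !big_nil pure_tensor0r.
by rewrite !big_cons pure_tensorDr IHr.
Qed.

Lemma pure_tensor_suml (I : Type) (r : seq I) (x : I -> M) s :
  pure_tensor phi (\sum_(i <- r) x i) s = \sum_(i <- r) pure_tensor phi (x i) s.
Proof.
elim: r => [|i r IHr]; last by rewrite !big_cons pure_tensorD IHr.
by rewrite !big_nil pure_tensor0l.
Qed.

Lemma tensor_sum_pure (z : tensor phi M) :
  z = \sum_(p <- trepr z) pure_tensor phi p.1 p.2.
Proof.
rewrite -[LHS]treprK; elim: (trepr z) => [|[x s] u IHu]; first by rewrite big_nil.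
by rewrite tpi_cons IHu big_cons.
Qed.

Lemma eq_linear_tensor (N : lmodType S) (f g : {linear tensor phi M -> N}) :
  (forall x, f (pure_tensor phi x 1) = g (pure_tensor phi x 1)) -> f =1 g.
Proof.
move=> fg z; rewrite (tensor_sum_pure z) !linear_sum; apply: eq_bigr => p _.
by rewrite pure_tensor_scale !linearZ fg.
Qed.

Section Lift.
Variables (N : lmodType S) (g : M -> N).
Hypothesis gD : forall x y, g (x + y) = g x + g y.
Hypothesis gZ : forall a x, g (a *: x) = phi a *: g x.

Definition seq_lift (u : seq (M * S)) : N := \sum_(p <- u) p.2 *: g p.1.

Lemma seq_lift_tens_eq u v : tens_eq phi u v -> seq_lift u = seq_lift v.
Proof.
rewrite /seq_lift.
elim=> {u v} [//|//|u v w _ -> //|u u' v v' _ e1 _ e2|u v||x y s|x s t|a x s].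
- by rewrite !big_cat /= e1 e2.
- by rewrite !big_cat /= addrC.
- by rewrite big_seq1 scale0r big_nil.
- by rewrite !big_cons !big_nil !addr0 gD scalerDr.
- by rewrite !big_cons !big_nil !addr0 scalerDl.
- by rewrite !big_seq1 /= gZ scalerA mulrC.
Qed.

Definition tensor_lift (z : tensor phi M) : N := seq_lift (trepr z).

Lemma tensor_lift_tpi u : tensor_lift (tpi phi u) = seq_lift u.
Proof. exact/seq_lift_tens_eq/trepr_pi. Qed.

Lemma tensor_lift_pure x s : tensor_lift (pure_tensor phi x s) = s *: g x.
Proof. by rewrite tensor_lift_tpi /seq_lift big_seq1. Qed.

Lemma tensor_lift_linear : linear tensor_lift.
Proof.
move=> a y z; rewrite -(treprK y) -(treprK z) [a *: _]tens_scaleE [_ + _]tens_addE.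
rewrite !tensor_lift_tpi /seq_lift big_cat big_map scaler_sumr; congr (_ + _).
by apply: eq_bigr => p _; rewrite scalerA.
Qed.

Lemma exists_tensor_lift :
  exists f : {linear tensor phi M -> N}, forall x s, f (pure_tensor phi x s) = s *: g x.
Proof.
pose L := GRing.isLinear.Build S (tensor phi M) N _ tensor_lift tensor_lift_linear.
pose f : {linear tensor phi M -> N} := HB.pack tensor_lift L.
by exists f => x s; apply: tensor_lift_pure.
Qed.

End Lift.
End TensorLift.

(* A frame exhibits M as a direct summand of the free module of rank n, so that
   linear maps between framed modules become matrices (acting on row vectors). *)
Record frame (A : comPzRingType) (n : nat) (M : lmodType A) := Frame {
  fcoord : {linear M -> 'rV[A]_n};
  fvec : {linear 'rV[A]_n -> M};
  fvecK : cancel fcoord fvec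
}.

Section FrameMatrix.
Variables (A : comPzRingType) (n : nat).

Definition fmx (M N : lmodType A) (e : frame n M) (e' : frame n N) (f : M -> N) : 'M[A]_n :=
  \matrix_(a, b) fcoord e' (f (fvec e 'e_a)) 0 b.

Definition mxf (M N : lmodType A) (e : frame n M) (e' : frame n N) (T : 'M[A]_n) (x : M) : N :=
  fvec e' (fcoord e x *m T).

Lemma mxf_linear (M N : lmodType A) (e : frame n M) (e' : frame n N) T : linear (mxf e e' T).
Proof. by move=> a x y; rewrite /mxf !linearP mulmxDl -scalemxAl linearP. Qed.

HB.instance Definition _ (M N : lmodType A) (e : frame n M) (e' : frame n N) T :=
  GRing.isLinear.Build A M N _ (mxf e e' T) (mxf_linear e e' T).

Lemma fmxE (M N : lmodType A) (e : frame n M) (e' : frame n N) (f : {linear M -> N}) r :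
  fcoord e' (f (fvec e r)) = r *m fmx e e' f.
Proof.
rewrite {1}[r]row_sum_delta !linear_sum; apply/rowP => b; rewrite summxE mxE.
by apply: eq_bigr => a _; rewrite !linearZ !mxE.
Qed.

Lemma fmx_coord (M N : lmodType A) (e : frame n M) (e' : frame n N) (f : {linear M -> N}) x :
  fcoord e' (f x) = fcoord e x *m fmx e e' f.
Proof. by rewrite -fmxE fvecK. Qed.

Lemma eq_mulmx_row (X Y : 'M[A]_n) : (forall r : 'rV_n, r *m X = r *m Y) -> X = Y.
Proof. by move=> XY; apply/row_matrixP => i; rewrite !rowE. Qed.

Lemma fmx_comp (M N L : lmodType A) (e : frame n M) (e' : frame n N) (e'' : frame n L)
    (f : {linear M -> N}) (g : {linear N -> L}) (h : M -> L) :
  (forall x, h x = g (f x)) -> fmx e e'' h = fmx e e' f *m fmx e' e'' g.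
Proof.
move=> hE; rewrite [LHS](_ : _ = fmx e e'' (g \o f)).
  apply: eq_mulmx_row => r; rewrite -fmxE mulmxA -fmxE -fmxE fvecK //.
by apply/matrixP => a b; rewrite !mxE hE.
Qed.

Lemma eq_fmx (M N : lmodType A) (e : frame n M) (e' : frame n N) (f g : M -> N) :
  f =1 g -> fmx e e' f = fmx e e' g.
Proof. by move=> fg; apply/matrixP => a b; rewrite !mxE fg. Qed.

Lemma fmxD (M N : lmodType A) (e : frame n M) (e' : frame n N) (f g h : M -> N) :
  (forall x, h x = f x + g x) -> fmx e e' h = fmx e e' f + fmx e e' g.
Proof. by move=> hE; apply/matrixP => a b; rewrite !mxE hE linearD mxE. Qed.

Lemma fmxB (M N : lmodType A) (e : frame n M) (e' : frame n N) (f g h : M -> N) :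
  (forall x, h x = f x - g x) -> fmx e e' h = fmx e e' f - fmx e e' g.
Proof. by move=> hE; apply/matrixP => a b; rewrite !mxE hE linearB !mxE. Qed.

(** In general [fmx e e id] is not [1%:M] but the idempotent projecting the free module onto its
    summand; by [fvecK], matrices of linear maps absorb it on both sides. *)
Lemma fmx_id_l (M N : lmodType A) (e : frame n M) (e' : frame n N) (f : {linear M -> N}) :
  fmx e e id *m fmx e e' f = fmx e e' f.
Proof.
by apply: eq_mulmx_row => r; rewrite mulmxA -(fmxE e e idfun) -!fmxE fvecK.
Qed.

Lemma fmx_id_r (M N : lmodType A) (e : frame n M) (e' : frame n N) (f : {linear M -> N}) :
  fmx e e' f *m fmx e' e' id = fmx e e' f.
Proof.
by apply: eq_mulmx_row => r; rewrite mulmxA -fmxE -(fmxE e' e' idfun) fvecK.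
Qed.

Lemma fcoord_id (M : lmodType A) (e : frame n M) x :
  fcoord e x *m fmx e e id = fcoord e x.
Proof. by rewrite -(fmx_coord e e idfun). Qed.

Lemma fcoord_vec (M : lmodType A) (e : frame n M) r :
  fcoord e (fvec e r) = r *m fmx e e id.
Proof. by rewrite -(fmxE e e idfun). Qed.

Lemma fcoord_inj (M : lmodType A) (e : frame n M) : injective (fcoord e).
Proof. exact: can_inj (fvecK e). Qed.

Lemma fmx_dom0 (M N : lmodType A) (e : frame n M) (e' : frame n N) (f : {linear M -> N}) :
  (forall x : M, x = 0) -> fmx e e' f = 0.
Proof.
by move=> M0; apply/matrixP => a b; rewrite !mxE [fvec e _]M0 !linear0 mxE.
Qed.

(** Projectivity in the form needed for homotopies: only values of [f] must have preimages, so [g]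
    may fail to be surjective. Preimages are chosen on the images of the basis vectors and extended
    through coordinates. *)
Lemma frame_lift (X M N : lmodType A) (e : frame n X) (f : {linear X -> N}) (g : {linear M -> N}) :
  (forall x, exists y, g y = f x) -> exists h : {linear X -> M}, forall x, g (h x) = f x.
Proof.
move=> fg; have [y yE] := choice (fun a : 'I_n => fg (fvec e 'e_a)).
pose h (x : X) := \sum_a fcoord e x 0 a *: y a.
have h_linear : linear h.
  move=> c x x'; rewrite /h scaler_sumr -big_split; apply: eq_bigr => a _ /=.
  by rewrite linearP !mxE scalerDl scalerA.
pose L := GRing.isLinear.Build A X M _ h h_linear.
exists (HB.pack h L : {linear X -> M}) => x /=.
rewrite /h linear_sum -[in RHS](fvecK e x) {2}[fcoord e x]row_sum_delta !linear_sum.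
by apply: eq_bigr => a _; rewrite !linearZ yE.
Qed.

End FrameMatrix.

(** Surplus basis vectors can be sent to 0, so every rank from [n0] on is allowed; modules with
    different numbers of generators can then share one matrix size. *)
Lemma fin_gen_projective_frame (R : comPzRingType) (M : lmodType R) :
  fin_gen M -> projective M -> exists n0, forall n, (n0 <= n)%N -> inhabited (frame n M).
Proof.
move=> [n0 [v vgen]] Mproj; exists n0 => n le_n.
pose g (r : 'rV[R]_n) : M := \sum_(i < n0) r 0 (widen_ord le_n i) *: v i.
have g_linear : linear g.
  move=> c x y; rewrite /g scaler_sumr -big_split; apply: eq_bigr => a _ /=.
  by rewrite !mxE scalerDl scalerA.
pose L := GRing.isLinear.Build R 'rV[R]_n M _ g g_linear.
pose g' : {linear 'rV[R]_n -> M} := HB.pack g L.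
have [|h hK] := Mproj _ _ g' idfun; last by constructor; exact: Frame hK.
move=> x; have [c xE] := vgen x.
exists (\row_j if insub (val j) is Some i then c i else 0) => /=.
rewrite /g xE; apply: eq_bigr => i _; rewrite !mxE.
case: insubP => [j _ jE|]; last by rewrite /= ltn_ord.
by congr (c _ *: _); apply/val_inj.
Qed.

Section BaseChangeFrame.
Variables (R S : comPzRingType) (phi : {rmorphism R -> S}) (n : nat).

(** The frame chosen from this existence statement is known only through the two formulas, which
    suffice to compute the matrix of [tensor_map phi f]. *)
Lemma base_change_frame_subproof (M : lmodType R) (e : frame n M) :
  exists f : frame n (tensor phi M),
    (forall x s, fcoord f (pure_tensor phi x s) = s *: map_mx phi (fcoord e x)) /\
    (forall r, fvec f r = \sum_a r 0 a *: pure_tensor phi (fvec e 'e_a) 1).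
Proof.
have [||c cE] := @exists_tensor_lift _ _ phi M 'rV[S]_n (fun x => map_mx phi (fcoord e x)).
- by move=> x y; rewrite linearD map_mxD.
- by move=> a x; rewrite linearZ map_mxZ.
pose v (r : 'rV[S]_n) := \sum_a r 0 a *: pure_tensor phi (fvec e 'e_a) 1.
have v_linear : linear v.
  move=> a x y; rewrite /v scaler_sumr -big_split; apply: eq_bigr => i _ /=.
  by rewrite !mxE scalerDl scalerA.
pose L := GRing.isLinear.Build S 'rV[S]_n (tensor phi M) _ v v_linear.
pose v' : {linear 'rV[S]_n -> tensor phi M} := HB.pack v L.
have cK : cancel c v'.
  apply: (@eq_linear_tensor _ _ phi M (tensor phi M) (v' \o c) idfun) => x /=.
  rewrite /= cE scale1r /v -[in RHS](fvecK e x) [fcoord e x in RHS]row_sum_delta.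
  rewrite linear_sum pure_tensor_suml; apply: eq_bigr => a _.
  by rewrite linearZ pure_tensorZ mulr1 [RHS]pure_tensor_scale mxE.
by exists (Frame cK).
Qed.

Definition base_change_frame (M : lmodType R) (e : frame n M) : frame n (tensor phi M) :=
  sval (cid (base_change_frame_subproof e)).

Lemma base_change_fmx (M N : lmodType R) (e : frame n M) (e' : frame n N) (f : {linear M -> N}) :
  fmx (base_change_frame e) (base_change_frame e') (tensor_map phi f) =
  map_mx phi (fmx e e' f).
Proof.
rewrite /base_change_frame; case: cid => /= d [_ vE]; case: cid => /= d' [cE _].
apply/matrixP => a b; rewrite !mxE vE (bigD1 a) //= big1 => [|i ia].
  by rewrite mxE !eqxx scale1r addr0 tensor_map_pure cE !mxE mul1r.
by rewrite mxE eqxx (negPf ia) scale0r.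
Qed.

Lemma base_change_fmx_id (M : lmodType R) (e : frame n M) :
  fmx (base_change_frame e) (base_change_frame e) id = map_mx phi (fmx e e id).
Proof.
rewrite -(base_change_fmx e e idfun); apply: eq_fmx.
apply: (@eq_linear_tensor _ _ phi M (tensor phi M) idfun (tensor_map phi idfun)) => x /=.
by rewrite tensor_map_pure.
Qed.

End BaseChangeFrame.

(** * Homotopies and the derived category *)

(** Homotopies and lifts arise in degrees [i + 1], while [j - 1 + 1] is equal but not convertible to
    [j]. The transport is harmless because equality proofs in [int] are unique. *)
Lemma reindex_succ (T : int -> Type) (s : forall i, T (i + 1)) :
  exists g : forall j, T j, forall i, g (i + 1) = s i.
Proof.
exists (fun j => eq_rect _ T (s (j - 1)) _ (subrK 1 j)) => i.
move: (subrK _ _); have -> : i + 1 - 1 = i by rewrite addrK.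
by move=> e; rewrite (eq_irrelevance e erefl).
Qed.

Lemma forall_succ (T : int -> Prop) : (forall i, T (i + 1)) -> forall j, T j.
Proof. by move=> h j; rewrite -(subrK 1 j). Qed.

Section Homotopy.
Variable A : comPzRingType.
Implicit Types X Y Z : complex A.

Definition homotopic X Y (f g : cmap X Y) : Prop :=
  exists h : forall i, {linear X (i + 1) -> Y i},
    forall i x, f (i + 1) x - g (i + 1) x = cdiff Y i (h i x) + h (i + 1) (cdiff X (i + 1) x).

Definition acyclic Y := forall i (y : Y (i + 1)), cpx_cycle y -> cpx_boundary y.

Definition framed X := exists n, forall i, inhabited (frame n (X i)).

(** The homotopy is built downwards from the top degree of [X]: the equation one degree higher makes
    [f - s d] take values in cycles, which are boundaries, so [frame_lift] supplies the next
    component. *)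
Lemma nullhomotopy X Y (f : cmap X Y) :
  bounded X -> framed X -> acyclic Y ->
  exists s : forall i, {linear X (i + 1) -> Y i},
    forall i x, f (i + 1) x = cdiff Y i (s i x) + s (i + 1) (cdiff X (i + 1) x).
Proof.
move=> [B X0] [n Xfr] Yac.
pose good (s : forall i, {linear X (i + 1) -> Y i}) i := forall x,
  f (i + 1) x = cdiff Y i (s i x) + s (i + 1) (cdiff X (i + 1) x).
have X0' (i : int) : (B%:Z < i + 1) || (i + 1 < - B%:Z) -> forall x : X (i + 1), x = 0.
  by move=> Bi; apply: X0; move: Bi; rewrite -[(_ < _)%N]ltz_nat abszE ltrNr -lter_normr.
have good0 s i : (forall x : X (i + 1), x = 0) -> good s i.
  by move=> Xi0 x; rewrite (Xi0 x) !linear0 addr0.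
suff gs (k : nat) : exists s, forall i : int, B%:Z - k%:Z <= i -> good s i.
  (* As [B - (2 * B).+2 = - B - 2], any remaining [i] has [i + 1 < - B], where [X] vanishes. *)
  have [s sP] := gs (2 * B).+2; exists s => i.
  have [|iB] := lerP (B%:Z - ((2 * B).+2)%:Z) i; first exact: sP.
  by apply/good0/X0'; apply/orP; right; lia.
elim: k => [|k [s sP]].
  exists (fun i => \0) => i; rewrite subr0 => Bi.
  by apply/good0/X0'; rewrite ltzD1 Bi.
pose i0 : int := B%:Z - k.+1%:Z.
pose r x := f (i0 + 1) x - s (i0 + 1) (cdiff X (i0 + 1) x).
have r_linear : linear r.
  by move=> c x y; rewrite /r !linearP /= scalerDr addrACA.
pose L := GRing.isLinear.Build A _ _ _ r r_linear.
pose r' : {linear X (i0 + 1) -> Y (i0 + 1)} := HB.pack r L.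
have [e] := Xfr (i0 + 1).
have [x|t tP] := @frame_lift A n _ _ _ e r' (cdiff Y i0).
  apply: Yac; rewrite /cpx_cycle /= /r linearB -cfunP sP; last by rewrite /i0; lia.
  by rewrite cdiffK linear0 addr0 subrr.
(* Only component [i0] changes; the equations for [i > i0] involve [s i] and [s (i + 1)], hence stay
   valid. *)
exists (dfwith s t) => i Bi; have [->|ii0] := eqVneq i i0.
  move=> x; rewrite dfwith_in dfwith_out; last by rewrite /i0; lia.
  by rewrite tP /= /r subrK.
by move=> x; rewrite !dfwith_out; [apply: sP| |]; move: Bi ii0; rewrite /i0; lia.
Qed.

Lemma homotopic_refl X Y (f g : cmap X Y) : (forall i, f i =1 g i) -> homotopic f g.
Proof. by move=> fg; exists (fun i => \0) => i x; rewrite fg subrr linear0 addr0. Qed.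

Lemma homotopic_sym X Y (f g : cmap X Y) : homotopic f g -> homotopic g f.
Proof.
move=> [h hP]; exists (fun i => \- h i) => i x /=.
by rewrite linearN -opprD -hP opprB.
Qed.

Lemma homotopic_trans X Y (f g k : cmap X Y) :
  homotopic f g -> homotopic g k -> homotopic f k.
Proof.
move=> [h hP] [h' hP']; exists (fun i => h i \+ h' i) => i x /=.
by rewrite -(subrKA (g (i + 1) x)) hP hP' linearD addrACA.
Qed.

Lemma comp_cmap_subproof X Y Z (f : cmap X Y) (g : cmap Y Z) i x :
  (g (i + 1) \o f (i + 1)) (cdiff X i x) = cdiff Z i ((g i \o f i) x).
Proof. by rewrite /= !cfunP. Qed.

Definition comp_cmap X Y Z (g : cmap Y Z) (f : cmap X Y) : cmap X Z :=
  @Cmap _ X Z (fun i => g i \o f i) (comp_cmap_subproof f g).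

Definition id_cmap X : cmap X X := @Cmap _ X X (fun i => idfun) (fun _ _ => erefl).

Lemma homotopic_compl X Y Z (g : cmap Y Z) (f f' : cmap X Y) :
  homotopic f f' -> homotopic (comp_cmap g f) (comp_cmap g f').
Proof.
move=> [h hP]; exists (fun i => g i \o h i) => i x /=.
by rewrite -linearB hP linearD cfunP.
Qed.

Lemma homotopic_compr X Y Z (g g' : cmap Y Z) (f : cmap X Y) :
  homotopic g g' -> homotopic (comp_cmap g f) (comp_cmap g' f).
Proof. by move=> [h hP]; exists (fun i => h i \o f (i + 1)) => i x /=; rewrite hP cfunP. Qed.

Definition shift_obj X (i : int) : lmodType A := X (i + 1).

Lemma shift_diffK X i (x : shift_obj X i) :
  - cdiff X (i + 1 + 1) (- cdiff X (i + 1) x) = 0.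
Proof. by rewrite linearN opprK cdiffK. Qed.

Definition shift X : complex A :=
  @Complex _ (shift_obj X) (fun i => \- cdiff X (i + 1)) (shift_diffK (X := X)).

(** * Mapping cones and lifting through quasi-isomorphisms *)

Section Cone.
Variables (Y Z : complex A) (w : cmap Y Z).

Definition cone_obj (i : int) : lmodType A := (Y (i + 1)%R * Z i)%type.

Definition cone_fun i (p : cone_obj i) : cone_obj (i + 1) :=
  (- cdiff Y (i + 1) p.1, w (i + 1) p.1 + cdiff Z i p.2).

Lemma cone_linear i : linear (@cone_fun i).
Proof.
move=> a p q; congr (_, _); rewrite /= !linearP /=; first by [].
by rewrite scalerDr addrACA.
Qed.

HB.instance Definition _ i :=
  GRing.isLinear.Build A (cone_obj i) (cone_obj (i + 1)%R) _ (@cone_fun i) (@cone_linear i).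

Lemma cone_diffK i (p : cone_obj i) : cone_fun (cone_fun p) = 0.
Proof.
congr (_, _); rewrite /= ?linearN ?linearD /= ?cdiffK ?oppr0 //.
by rewrite cfunP addr0 addNr.
Qed.

Definition cone : complex A := @Complex _ cone_obj (fun i => @cone_fun i) cone_diffK.

(** For a cycle [(y, z)], injectivity of [w] on cohomology gives [y = d y0]; surjectivity then
    writes the cycle [z + w y0] as the image of a cycle up to a boundary. *)
Lemma cone_acyclic : quasi_iso w -> acyclic cone.
Proof.
move=> wq i [y z] [] /eqP; rewrite oppr_eq0 => /eqP /= dy wydz.
have [|y0 y0E] := (wq (i + 1)).1 y dy.
  by exists (- z); rewrite linearN; apply/esym/eqP; rewrite -addr_eq0; apply/eqP.
have dz' : cdiff Z (i + 1) (z + w (i + 1) y0) = 0.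
  by rewrite linearD -cfunP y0E [LHS]addrC.
have [y1 dy1 [z1 z1E]] := (wq i).2 _ dz'.
exists (y1 - y0, - z1); congr (_, _) => /=; first by rewrite linearB dy1 sub0r opprK.
rewrite linearN z1E linearB opprB; set u := w _ _; set v := w _ _.
by rewrite [LHS]addrC addrA subrK addrK.
Qed.

End Cone.

Section Lifting.
Variables (X Y Z : complex A) (w : cmap Y Z).
Hypotheses (Xb : bounded X) (Xf : framed X) (wq : quasi_iso w).

Lemma bounded_shift : bounded (shift X).
Proof. by have [B X0] := Xb; exists B.+1 => i iB; apply: X0; lia. Qed.

Lemma framed_shift : framed (shift X).
Proof. by have [n Xfr] := Xf; exists n => i; apply: Xfr. Qed.

(** A nullhomotopy of [(0, f) : X -> cone w] is exactly a lift: its first component is the chain map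
    [g], its second a homotopy between [f] and [w g]. *)
Lemma quasi_iso_lift (f : cmap X Z) : exists g : cmap X Y, homotopic (comp_cmap w g) f.
Proof.
pose c i (x : X i) : cone w i := (0, f i x).
have c_linear i : linear (c i).
  by move=> a x y; congr (_, _); rewrite /= ?linearP // scaler0 addr0.
pose L i := GRing.isLinear.Build A (X i) (cone w i) _ (c i) (c_linear i).
pose c' i : {linear X i -> cone w i} := HB.pack (c i) (L i).
have cP i x : c' (i + 1) (cdiff X i x) = cdiff (cone w) i (c' i x).
  by congr (_, _); rewrite /= linear0 ?oppr0 // add0r cfunP.
have [s sP] := nullhomotopy (Cmap cP) Xb Xf (cone_acyclic wq).
have [g gE] := @reindex_succ (fun i => {linear X i -> Y i}) (fun i => fst \o s i).
have gP : forall i x, g (i + 1) (cdiff X i x) = cdiff Y i (g i x).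
  apply: forall_succ => i x; have [/esym/eqP] := sP i x.
  by rewrite [X in X == _]addrC subr_eq0 !gE => /eqP.
exists (Cmap gP); apply: homotopic_sym; exists (fun i => snd \o s i) => i x.
by have [_ /= ->] := sP i x; rewrite gE /=; set u := w _ _; rewrite -(addrA u) [LHS]addrC addKr.
Qed.

(** A homotopy [h] from [w g] to [w g'] makes [(g - g', - h)] a chain map from [shift X] to the
    cone; the first component of a nullhomotopy of it is, up to sign, a homotopy from [g] to
    [g']. *)
Lemma quasi_iso_lift_unique (g g' : cmap X Y) :
  homotopic (comp_cmap w g) (comp_cmap w g') -> homotopic g g'.
Proof.
move=> [h hP].
pose c i (x : shift X i) : cone w i := (g (i + 1) x - g' (i + 1) x, - h i x).
have c_linear i : linear (c i).
  move=> a x y; congr (_, _) => /=; last by rewrite !linearP.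
  by rewrite !linearP /= scalerDr addrACA.
pose L i := GRing.isLinear.Build A (shift X i) (cone w i) _ (c i) (c_linear i).
pose c' i : {linear shift X i -> cone w i} := HB.pack (c i) (L i).
have cP i x : c' (i + 1) (cdiff (shift X) i x) = cdiff (cone w) i (c' i x).
  congr (_, _) => /=; first by rewrite !linearN linearB !cfunP opprB opprK [RHS]addrC.
  by rewrite linearB hP !linearN opprK /= [RHS]addrC addKr.
have [s sP] := nullhomotopy (Cmap cP) bounded_shift framed_shift (cone_acyclic wq).
have [k kE] := @reindex_succ (fun i => {linear X (i + 1) -> Y i}) (fun i => \- (fst \o s i)).
exists k; apply: forall_succ => i x; have [/= -> _] := sP i x.
by rewrite !kE /= !linearN.
Qed.

End Lifting.

(* The effect of a word of the derived category on homotopy classes of maps out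
   of X, as a relation: a formal inverse of w is interpreted by lifting through w. *)
Fixpoint dact X Y Z (p : dpath Y Z) : cmap X Y -> cmap X Z -> Prop :=
  match p in dpath Y Z return cmap X Y -> cmap X Z -> Prop with
  | dnil _ => fun a b => homotopic a b
  | dfwd _ _ _ f p => fun a b => dact p (comp_cmap f a) b
  | dbwd _ _ _ w _ p => fun a b => exists2 a', homotopic (comp_cmap w a') a & dact p a' b
  end.

Lemma dact_homotopic X Y Z (p : dpath Y Z) (a a' : cmap X Y) b :
  homotopic a a' -> dact p a b -> dact p a' b.
Proof.
elim: p a a' b => [W|W Y' W' f p IHp|W Y' W' w wq p IHp] a a' b aa' /=.
- exact/homotopic_trans/homotopic_sym.
- exact/IHp/homotopic_compl.
- by move=> [c cE pc]; exists c => //; apply: homotopic_trans aa'.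
Qed.

(** Naturality in the source: from the effect of [p] on an identity map it yields the effect on an
    arbitrary map. *)
Lemma dact_comp X' X Y Z (p : dpath Y Z) (c : cmap X' X) (a : cmap X Y) (b : cmap X Z) :
  dact p a b -> dact p (comp_cmap a c) (comp_cmap b c).
Proof.
elim: p a b => [W|W Y' W' f p IHp|W Y' W' w wq p IHp] a b /=.
- exact: homotopic_compr.
- by move/IHp; apply: dact_homotopic; apply: homotopic_refl.
- move=> [a' a'E /IHp pa']; exists (comp_cmap a' c) => //.
  apply: homotopic_trans (homotopic_compr c a'E); exact: homotopic_refl.
Qed.

Section Dact.
Variable X : complex A.
Hypotheses (Xb : bounded X) (Xf : framed X).

Lemma dact_total Y Z (p : dpath Y Z) (a : cmap X Y) : exists b, dact p a b.
Proof.
elim: p a => [W|W Y' W' f p IHp|W Y' W' w wq p IHp] a /=.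
- by exists a; apply: homotopic_refl.
- exact: IHp.
- by have [c cE] := quasi_iso_lift Xb Xf wq a; have [b] := IHp c; exists b, c.
Qed.

Lemma dact_functional Y Z (p : dpath Y Z) (a : cmap X Y) b b' :
  dact p a b -> dact p a b' -> homotopic b b'.
Proof.
elim: p a b b' => [W|W Y' W' f p IHp|W Y' W' w wq p IHp] a b b' /=.
- by move/homotopic_sym; apply: homotopic_trans.
- exact: IHp.
- move=> [c cE pc] [c' c'E pc']; apply: (IHp c) => //.
  apply: dact_homotopic pc'; apply: (quasi_iso_lift_unique Xb Xf wq).
  exact/(homotopic_trans c'E)/homotopic_sym.
Qed.

Lemma dact_cat Y Z W (p : dpath Y Z) (q : dpath Z W) (a : cmap X Y) b c :
  dact p a c -> dact (dcat p q) a b -> dact q c b.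
Proof.
elim: p q a b c => [V|V Y' W' f p IHp|V Y' W' w wq p IHp] q a b c /=.
- exact: dact_homotopic.
- exact: IHp.
- move=> [d dE pd] [d' d'E pd']; apply: (IHp q d) => //.
  apply: dact_homotopic pd'; apply: (quasi_iso_lift_unique Xb Xf wq).
  exact/(homotopic_trans d'E)/homotopic_sym.
Qed.

(** Cancelling [w] against a following formal inverse rests on uniqueness of lifts, cancelling the
    inverse against a following [w] on their existence. *)
Lemma dact_eq Y Z (p q : dpath Y Z) :
  dpath_eq p q -> forall (a : cmap X Y) b, dact p a b <-> dact q a b.
Proof.
elim=> {Y Z p q}
  [//|Y Z p q _ IH|Y Z p q r _ IH1 _ IH2|Y Z W f p q _ IH|Y Z W w wq p q _ IH
  |Y Z e p eE|Y Z V W f g h p hE|Y Z W w wq p|Y Z W w wq p] a b /=.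
- by rewrite IH.
- by rewrite IH1.
- exact: IH.
- by split=> -[c cE /IH]; exists c.
- by split; apply: dact_homotopic; apply: homotopic_refl => i x /=; rewrite eE.
- by split; apply: dact_homotopic; apply: homotopic_refl => i x /=; rewrite hE.
- split=> [[c cE]|pa]; last by exists a => //; apply: homotopic_refl.
  exact/dact_homotopic/(quasi_iso_lift_unique Xb Xf wq).
- split=> [[c cE]|pa]; first exact: dact_homotopic.
  have [c cE] := quasi_iso_lift Xb Xf wq a; exists c => //.
  exact: dact_homotopic (homotopic_sym cE) pa.
Qed.

End Dact.

Lemma derived_iso_homotopy_equiv X Y :
  bounded X -> framed X -> bounded Y -> framed Y -> derived_iso X Y ->
  exists (F : cmap X Y) (G : cmap Y X),
    homotopic (comp_cmap G F) (id_cmap X) /\ homotopic (comp_cmap F G) (id_cmap Y).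
Proof.
move=> Xb Xf Yb Yf [f [g [fg gf]]].
have inv Z W (p : dpath Z W) (q : dpath W Z) (a : cmap Z W) : bounded Z -> framed Z ->
    dpath_eq (dcat p q) (dnil Z) -> dact p (id_cmap Z) a -> dact q a (id_cmap Z).
  move=> Zb Zf pq pa; apply: (dact_cat Zb Zf pa).
  by apply/(dact_eq Zb Zf pq); apply: homotopic_refl.
(* The chain maps representing [f] and [g] are their values on identity maps. *)
have [F fF] := dact_total Xb Xf f (id_cmap X).
have [G gG] := dact_total Yb Yf g (id_cmap Y).
exists F, G; split.
- apply: (@dact_functional X Xb Xf _ _ g F); last exact: (inv _ _ f).
  have := dact_comp F gG; apply: dact_homotopic; exact: homotopic_refl.
- apply: (@dact_functional Y Yb Yf _ _ f G); last exact: (inv _ _ g).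
  have := dact_comp G fF; apply: dact_homotopic; exact: homotopic_refl.
Qed.

End Homotopy.

Lemma quasi_iso_derived_iso (A : pzRingType) (X Y : complex A) (f : cmap X Y) :
  quasi_iso f -> derived_iso X Y.
Proof.
move=> fq; exists (dfwd f (dnil Y)), (dbwd fq (dnil X)); split => /=.
- exact: deq_fwd_bwd.
- exact: deq_bwd_fwd.
Qed.

(** * Flatness and polynomial specialization *)

Section Kernel.
Variables (A : pzRingType) (M N : lmodType A) (g : {linear M -> N}).

Definition ker_pred : {pred M} := [pred x | g x == 0].

Lemma ker_submod_closed : submod_closed ker_pred.
Proof.
split=> [|a x y]; rewrite !inE ?linear0 // => /eqP gx /eqP gy.
by rewrite linearP gx gy scaler0 addr0.
Qed.

HB.instance Definition _ := GRing.isSubmodClosed.Build A M ker_pred ker_submod_closed.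

Record kernel := Kernel { ker_val : M; _ : ker_val \in ker_pred }.
HB.instance Definition _ := [isSub for ker_val].
HB.instance Definition _ := [Choice of kernel by <:].
HB.instance Definition _ := [SubChoice_isSubLmodule of kernel by <:].

Lemma ker_exact : exact_at (val : kernel -> M) g.
Proof.
move=> y; split=> [/eqP gy|[[x /eqP gx] <-] //].
by exists (Kernel (gy : y \in ker_pred)).
Qed.

End Kernel.

Section EquationalCriterion.
Variables (R : comNzRingType) (S : comPzRingType) (phi : {rmorphism R -> S}).

(** Flatness is applied to [kernel g' -> R^T -> R^J]: the vector [t], seen as an element [z] of
    [R^T] tensored with [S], is killed by the system, so it comes from the tensored kernel, whose
    elements are finite sums of pure tensors. *)
Lemma flat_solution_span (T J : finType) (L : T -> J -> R) (t : T -> S) :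
  flat phi -> (forall j, \sum_i t i * phi (L i j) = 0) ->
  exists k (c : 'I_k -> T -> R) (s : 'I_k -> S),
    (forall l j, \sum_i c l i * L i j = 0) /\
    (forall i, t i = \sum_l s l * phi (c l i)).
Proof.
move=> phi_flat tL.
pose g (c : {ffun T -> R^o}) : {ffun J -> R^o} := [ffun j => \sum_i c i * L i j].
have g_linear : linear g.
  move=> a x y; apply/ffunP => j; rewrite !ffunE scaler_sumr -big_split.
  by apply: eq_bigr => i _; rewrite !ffunE /= mulrDl scalerAl.
pose Lg := GRing.isLinear.Build R {ffun T -> R^o} {ffun J -> R^o} _ g g_linear.
pose g' : {linear {ffun T -> R^o} -> {ffun J -> R^o}} := HB.pack g Lg.
pose f : {linear kernel g' -> {ffun T -> R^o}} := val.
pose d (T' : finType) (i : T') : {ffun T' -> R^o} := [ffun i' => (i' == i)%:R].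
pose z : tensor phi {ffun T -> R^o} := \sum_i pure_tensor phi (d T i) (t i).
have gd i : g (d T i) = \sum_j L i j *: d J j.
  apply/ffunP => j; rewrite !ffunE sum_ffunE (bigD1 i) //= big1 ?addr0 => [|i' ii'].
    rewrite (bigD1 j) //= big1 ?addr0 => [|j' jj']; rewrite !ffunE ?eqxx ?mul1r ?scaler1 //.
      by rewrite [_ *: _]mulr1.
    by rewrite eq_sym (negPf jj') scaler0.
  by rewrite !ffunE (negPf ii') mul0r.
have [y yz] : exists y, tensor_map phi f y = z.
  apply/(phi_flat _ _ _ f g' (@ker_exact _ _ _ g') z).
  rewrite linear_sum /=; under eq_bigr => i _.
    rewrite tensor_map_pure /= gd pure_tensor_suml.
    under eq_bigr => j _ do rewrite pure_tensorZ mulrC.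
    over.
  rewrite exchange_big big1 //= => j _.
  by rewrite -pure_tensor_sumr tL pure_tensor0r.
(* Evaluation at [i], extended to the tensor product, recovers [t i] from [z]. *)
have ev i : exists e : {linear tensor phi {ffun T -> R^o} -> S^o},
    forall x s, e (pure_tensor phi x s) = s * phi (x i).
  apply: (@exists_tensor_lift _ _ phi {ffun T -> R^o} S^o (fun x => phi (x i))).
  - by move=> x x'; rewrite ffunE rmorphD.
  - by move=> a x; rewrite ffunE rmorphM.
pose r := trepr y; pose p l := tnth (in_tuple r) l.
exists (size r), (fun l i => f (p l).1 i), (fun l => (p l).2); split=> [l j|i].
  have /eqP/ffunP/(_ j) : val (p l).1 \in ker_pred g' by case: (p l).1.
  by rewrite !ffunE.
have [e eE] := ev i; have : e z = t i.
  rewrite linear_sum (bigD1 i) //= big1 ?addr0 => [|i' ii']; rewrite eE ffunE.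
    by rewrite eqxx rmorph1 mulr1.
  by rewrite eq_sym (negPf ii') rmorph0 mulr0.
move=> <-; rewrite -yz (tensor_sum_pure y) !linear_sum /= big_tnth.
by apply: eq_bigr => l _; rewrite /= tensor_map_pure eE.
Qed.

End EquationalCriterion.

Section QuotientModule.
Variables (R : comNzRingType) (I : idealr R).

Local Open Scope quotient_scope.

Definition quot_mod : Type := {ideal_quot I}.
HB.instance Definition _ := GRing.Zmodule.on quot_mod.

Definition quot_scale (a : R) (x : quot_mod) : quot_mod := \pi_{ideal_quot I} a * x.

Lemma quot_scaleA a b x : quot_scale a (quot_scale b x) = quot_scale (a * b) x.
Proof. by rewrite /quot_scale rmorphM mulrA. Qed.

Lemma quot_scale1 : left_id 1 quot_scale.
Proof. by move=> x; rewrite /quot_scale rmorph1 mul1r. Qed.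

Lemma quot_scaleDr : right_distributive quot_scale +%R.
Proof. by move=> a x y; rewrite /quot_scale mulrDr. Qed.

Lemma quot_scaleDl x : {morph quot_scale^~ x : a b / a + b}.
Proof. by move=> a b; rewrite /quot_scale rmorphD mulrDl. Qed.

HB.instance Definition _ := GRing.Zmodule_isLmodule.Build R quot_mod
  quot_scaleA quot_scale1 quot_scaleDr quot_scaleDl.

Lemma quot_mod_annihilated a (x : quot_mod) : a \in (I : {pred R}) -> a *: x = 0.
Proof.
move=> Ia; rewrite [LHS](_ : _ = \pi_{ideal_quot I} a * x) //.
suff -> : \pi_{ideal_quot I} a = 0 by rewrite mul0r.
by rewrite -(rmorph0 (\pi_{ideal_quot I})); apply/eqP; rewrite -Quotient.idealrBE subr0.
Qed.

Lemma quot_mod_nontrivial : exists x : quot_mod, x <> 0.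
Proof. by exists 1; apply/eqP; rewrite oner_eq0. Qed.

End QuotientModule.

Section ExtendedIdeal.
Variables (R : comNzRingType) (S : comPzRingType) (phi : {rmorphism R -> S}).
Variable m : set R.

(** The extension [mS], as finite sums, so that membership can be treated by induction on the number
    of terms. *)
Inductive ext_ideal : S -> Prop :=
| ext_ideal0 : ext_ideal 0
| ext_ideal_cons a s y : m a -> ext_ideal y -> ext_ideal (phi a * s + y).

Lemma ext_idealD x y : ext_ideal x -> ext_ideal y -> ext_ideal (x + y).
Proof.
by elim=> [|a s z ma _ IHz] yI; rewrite ?add0r // -addrA; apply/ext_ideal_cons/IHz.
Qed.

Lemma ext_idealM t y : ext_ideal y -> ext_ideal (t * y).
Proof.
elim=> [|a s z ma _ IHz]; first by rewrite mulr0; apply: ext_ideal0.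
by rewrite mulrDr mulrCA; apply: ext_ideal_cons.
Qed.

Lemma ext_idealB x y : ext_ideal x -> ext_ideal y -> ext_ideal (x - y).
Proof. by move=> xI yI; rewrite -mulN1r; apply/ext_idealD/ext_idealM. Qed.

Lemma ext_ideal_phi a : m a -> ext_ideal (phi a).
Proof. by move=> ma; rewrite -[phi a]mulr1 -[_ * _]addr0; apply/ext_ideal_cons/ext_ideal0. Qed.

(** Elements of [mS] annihilate [R/m] tensored with [S]. If 1 were among them this tensor product
    would vanish, and faithful flatness would force [R/m = 0]. *)
Lemma ext_ideal_proper : faithfully_flat phi -> is_ideal m -> ~ m 1 -> ~ ext_ideal 1.
Proof.
move=> [_ ff] [m0 mD mM] m1 I1.
pose mp : {pred R} := fun x => `[< m x >].
have mp_closed : idealr_closed mp.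
  split; [exact/asboolP|exact/asboolPn|move=> a u v /asboolP mu /asboolP mv].
  by apply/asboolP/mD => //; apply: mM.
pose I : idealr R := HB.pack (mp : R -> bool) (isIdealr.Build R mp mp_closed).
have [x] := quot_mod_nontrivial I; apply; apply: (ff (quot_mod I)) => z.
have kill y u s : ext_ideal y -> y *: pure_tensor phi (u : quot_mod I) s = 0.
  elim=> [|a t w ma _ IHw]; first by rewrite scale0r.
  rewrite scalerDl IHw addr0 mulrC -scalerA [phi a *: _]tens_scaleE /sc /=.
  rewrite -[tpi _ _]/(pure_tensor phi u (phi a * s)) -pure_tensorZ.
  rewrite quot_mod_annihilated ?pure_tensor0l ?scaler0 //.
  exact/asboolP.
rewrite (tensor_sum_pure z) big1 // => p _.
by rewrite -[LHS]scale1r kill.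
Qed.

End ExtendedIdeal.

(** * Polynomial functions on a commutative ring *)

Section PolynomialFunctions.
Variable S : comPzRingType.

(* Polynomial functions of degree < n, by divided differences: this is the only
   property of polynomials needed to count their zeros. *)
Fixpoint polf (n : nat) (p : S -> S) : Prop :=
  if n is n'.+1 then
    forall a, exists2 q, polf n' q & forall x, p x = p a + (x - a) * q x
  else forall x, p x = 0.

Definition ispol p := exists n, polf n p.

Lemma polf0 n p : (forall x, p x = 0) -> polf n p.
Proof.
elim: n p => [//|n IHn] p p0 a; exists (fun=> 0); first exact: IHn.
by move=> x; rewrite !p0 mulr0 addr0.
Qed.

Lemma polfS n p : polf n p -> polf n.+1 p.
Proof.
elim: n p => [p p0|n IHn p pP a]; first exact: polf0.
by have [q /IHn qP pE] := pP a; exists q.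
Qed.

Lemma polf_leq n k p : (n <= k)%N -> polf n p -> polf k p.
Proof.
move=> /subnKC <-; elim: (k - n)%N => [|d IHd] np; first by rewrite addn0.
by rewrite addnS; apply/polfS/IHd.
Qed.

Lemma polfD n p q : polf n p -> polf n q -> polf n (fun x => p x + q x).
Proof.
elim: n p q => [|n IHn] p q pP qP; first by move=> x; rewrite pP qP addr0.
move=> a; have [p' p'P pE] := pP a; have [q' q'P qE] := qP a.
exists (fun x => p' x + q' x); first exact: IHn.
by move=> x; rewrite pE qE mulrDr addrACA.
Qed.

Lemma polfZ n c p : polf n p -> polf n (fun x => c * p x).
Proof.
elim: n p => [|n IHn] p pP; first by move=> x; rewrite pP mulr0.
move=> a; have [p' p'P pE] := pP a; exists (fun x => c * p' x); first exact: IHn.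
by move=> x; rewrite pE mulrDr mulrCA.
Qed.

Lemma polfM n k p q : polf n p -> polf k q -> polf (n + k) (fun x => p x * q x).
Proof.
elim: n p => [|n IHn] p pP qP; first by apply: polf0 => x; rewrite pP mul0r.
case: k qP IHn => [|k] qP IHn; first by apply: polf0 => x; rewrite qP mulr0.
move=> a; have [p' p'P pE] := pP a; have [q' q'P qE] := qP a.
(* Leibniz rule for divided differences. *)
exists (fun x => p' x * q x + p a * q' x).
  apply: polfD; first exact: IHn.
  by apply: (@polf_leq k); [rewrite addnS leqW ?leq_addl|apply: polfZ].
move=> x; rewrite [in LHS]pE mulrDl [in p a * _]qE mulrDr -!addrA; congr (_ + _).
by rewrite addrC mulrDr -mulrA; congr (_ + _); rewrite mulrCA.
Qed.

Lemma ispol_cst c : ispol (fun=> c).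
Proof. by exists 1%N => a; exists (fun=> 0) => // x; rewrite mulr0 addr0. Qed.

Lemma ispol_id : ispol id.
Proof.
exists 2%N => a; exists (fun=> 1); last by move=> x; rewrite mulr1 addrC subrK.
by move=> b; exists (fun=> 0) => // x; rewrite mulr0 addr0.
Qed.

Lemma ispolD p q : ispol p -> ispol q -> ispol (fun x => p x + q x).
Proof.
move=> [n pP] [k qP]; exists (n + k)%N; apply: polfD.
  by apply: polf_leq pP; rewrite leq_addr.
by apply: polf_leq qP; rewrite leq_addl.
Qed.

Lemma ispolM p q : ispol p -> ispol q -> ispol (fun x => p x * q x).
Proof. by move=> [n pP] [k qP]; exists (n + k)%N; apply: polfM. Qed.

Lemma ispol_sum (I : Type) (r : seq I) (P : pred I) (p : I -> S -> S) :
  (forall i, ispol (p i)) -> ispol (fun x => \sum_(i <- r | P i) p i x).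
Proof.
move=> pP; elim: r => [|i r IHr].
  by have := ispol_cst 0; congr ispol; apply/funext => x; rewrite big_nil.
under eq_fun do rewrite big_cons.
by case: (P i) => //; apply: ispolD.
Qed.

Lemma ispol_prod (I : Type) (r : seq I) (P : pred I) (p : I -> S -> S) :
  (forall i, ispol (p i)) -> ispol (fun x => \prod_(i <- r | P i) p i x).
Proof.
move=> pP; elim: r => [|i r IHr].
  by have := ispol_cst 1; congr ispol; apply/funext => x; rewrite big_nil.
under eq_fun do rewrite big_cons.
by case: (P i) => //; apply: ispolM.
Qed.

Definition ispolmx k l (M : S -> 'M[S]_(k, l)) := forall a b, ispol (fun x => M x a b).

Lemma ispolmx_cst k l (C : 'M[S]_(k, l)) : ispolmx (fun=> C).
Proof. by move=> a b; apply: ispol_cst. Qed.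

Lemma ispolmxD k l (M N : S -> 'M[S]_(k, l)) :
  ispolmx M -> ispolmx N -> ispolmx (fun x => M x + N x).
Proof. by move=> MP NP a b; under eq_fun do rewrite mxE; apply: ispolD. Qed.

Lemma ispolmxN k l (M : S -> 'M[S]_(k, l)) : ispolmx M -> ispolmx (fun x => - M x).
Proof.
move=> MP a b; under eq_fun do rewrite mxE -mulN1r.
by apply: ispolM => //; apply: ispol_cst.
Qed.

Lemma ispolmxM k l h (M : S -> 'M[S]_(k, l)) (N : S -> 'M[S]_(l, h)) :
  ispolmx M -> ispolmx N -> ispolmx (fun x => M x *m N x).
Proof.
move=> MP NP a b; under eq_fun do rewrite mxE.
by apply: ispol_sum => i; apply: ispolM.
Qed.

Lemma ispol_det k (M : S -> 'M[S]_k) : ispolmx M -> ispol (fun x => \det (M x)).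
Proof.
move=> MP; apply: ispol_sum => s; apply: ispolM; first exact: ispol_cst.
by apply: ispol_prod => i; apply: MP.
Qed.

End PolynomialFunctions.

Section Specialization.
Variables (R : comNzRingType) (S : comPzRingType) (phi : {rmorphism R -> S}).
Variables (m : set R) (r : nat -> R).
Hypothesis r_unit : forall i j, i != j -> exists b, (r i - r j) * b = 1.

(** Dividing by [x - phi (r k)] lowers the degree, and the quotient stays in [mS] at the later
    points because [r i - r k] is a unit. Each division uses up one point, hence the moving bound
    [k]. *)
Lemma polf_vanish n p k :
  polf n p -> (forall i, (k <= i)%N -> ext_ideal phi m (p (phi (r i)))) ->
  forall x, ext_ideal phi m (p x).
Proof.
elim: n p k => [|n IHn] p k pP pr x; first by rewrite pP; apply: ext_ideal0.
have [q qP pE] := pP (phi (r k)).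
rewrite pE; apply: ext_idealD; first exact: pr.
apply/ext_idealM/(IHn _ k.+1 qP) => i ki.
have [|b bE] := @r_unit i k; first by rewrite gtn_eqF.
rewrite -[q _]mul1r -(rmorph1 phi) -bE rmorphM rmorphB [_ * phi b]mulrC -mulrA.
apply: ext_idealM; rewrite -[X in ext_ideal _ _ X](addKr (p (phi (r k)))) -pE addrC.
by apply: ext_idealB; apply: pr => //; apply: ltnW.
Qed.

(* The S-coordinates of c are replaced by elements of R one at a time. *)
Lemma pol_specialize k (D : ('I_k -> S) -> S) (c : 'I_k -> S) :
  (forall g : S -> 'I_k -> S, (forall l, ispol (g^~ l)) -> ispol (fun z => D (g z))) ->
  ~ ext_ideal phi m (D c) ->
  exists x : 'I_k -> R, ~ ext_ideal phi m (D (fun l => phi (x l))).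
Proof.
move=> DP Dc.
suff sP (s : seq 'I_k) : exists2 c, (forall l, l \in s -> exists x, c l = phi x) &
    ~ ext_ideal phi m (D c).
  have [c' c'R Dc'] := sP (enum 'I_k).
  have [x xE] := choice (fun l => c'R l (mem_enum _ l)).
  by exists x; rewrite -(funext xE).
elim: s => [|l s [c' c'R Dc']]; first by exists c.
pose g z l' := if l' == l then z else c' l'.
have [n gn] : ispol (fun z => D (g z)).
  by apply: DP => l'; rewrite /g; case: eqP => _; [apply: ispol_id|apply: ispol_cst].
(* Otherwise [polf_vanish] would put the value at [z = c' l], which is [D c'], into [mS]. *)
have [i gi] : exists i, ~ ext_ideal phi m (D (g (phi (r i)))).
  apply/not_existsP => gr; apply: Dc'.
  have -> : c' = g (c' l) by apply/funext => l'; rewrite /g; case: eqP => // ->.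
  by apply: (polf_vanish (k := 0) gn) => i _; apply: contrapT.
exists (g (phi (r i))) => // l'; rewrite inE /g; case: eqP => [_ _|_ /c'R //].
by exists (r i).
Qed.

End Specialization.

Section LocalRing.
Variables (R : comNzRingType) (m : set R).
Hypothesis R_local : local_ring m.

Lemma local_ring_unit a : ~ m a -> exists b, a * b = 1.
Proof.
move=> ma; apply: contrapT => aU.
pose proper (J : set R) := [/\ is_ideal J, ~ J 1 & J a].
have [J [PJ Jmax]] : exists J, (proper J \/ J = set0) /\
    forall K, (J `<` K)%classic -> ~ (proper K \/ K = set0).
  apply: Zorn_bigcup => F FP Ftot.
  have [[X [FX X0]]|F0] := pselect (exists X, F X /\ X <> set0); last first.
    right; apply/seteqP; split=> // x [X FX Xx]; case: F0; exists X; split=> //.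
    by move=> X0; rewrite X0 in Xx.
  have propF Y y : F Y -> Y y -> proper Y.
    by move=> /FP [//|Y0]; rewrite Y0.
  have [[X00 _ _] X1 Xa] : proper X by case: (FP _ FX).
  left; split; last by exists X.
    split=> [|x y [Y FY Yx] [Z FZ Zy]|b x [Y FY Yx]]; first by exists X.
      case: (Ftot _ _ FY FZ) => sub.
        by exists Z => //; have [[_ ZD _] _ _] := propF _ _ FZ Zy; apply: ZD => //; apply: sub.
      by exists Y => //; have [[_ YD _] _ _] := propF _ _ FY Yx; apply: YD => //; apply: sub.
    by exists Y => //; have [[_ _ YM] _ _] := propF _ _ FY Yx; apply: YM.
  by move=> [Y FY Y1]; have [_ /(_ Y1)] := propF _ _ FY Y1.
(* The principal ideal of the nonunit [a] is proper; it shows that the maximal [J] is not the empty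
   set. *)
have aP : proper (range (fun b => a * b)).
  split; last by exists 1 => //; rewrite mulr1.
    split=> [|_ _ [x _ <-] [y _ <-]|b _ [x _ <-]]; first by exists 0; rewrite ?mulr0.
      by exists (x + y); rewrite ?mulrDr.
    by exists (b * x); rewrite // mulrCA.
  by move=> [b _ ab]; apply: aU; exists b.
have {}PJ : proper J.
  case: PJ => // J0; case: (Jmax (range (fun b => a * b))); last by left.
  rewrite J0; rewrite classical_sets.properEneq; split=> //; apply/eqP.
  by move/seteqP => [_ /(_ a)]; apply; exists 1; rewrite ?mulr1.
have [Jid J1 Ja] := PJ.
case: R_local => _ /(_ J) mJ; apply: ma; rewrite -mJ //; split=> // K Kid K1 JK.
apply: contrapT => KJ; apply: (Jmax K); last by left; split=> //; apply: JK.
by rewrite classical_sets.properEneq; split=> //; apply/eqP => /esym.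
Qed.

Lemma infinite_residues : infinite_set (cosets m) ->
  exists r : nat -> R, forall i j, i != j -> exists b, (r i - r j) * b = 1.
Proof.
move=> /infiniteP/pcard_leP[f].
have fm i : exists x, [set y | m (y - x)]%classic = f i.
  have [x _ e] : cosets m (f i) by apply: funS.
  by exists x.
have [r rE] := choice fm.
exists r => i j ij; apply: local_ring_unit => mij; case/eqP: ij.
have [[[m0 mD mM] _ _] _] := R_local.
have fij : f i = f j.
  rewrite -(rE i) -(rE j); apply/seteqP; split=> y /= my.
    by rewrite -(subrKA (r i)); apply: mD.
  by rewrite -(subrKA (r j)); apply: mD => //; rewrite -opprB -mulN1r; apply: mM.
by apply: (@inj _ _ setT f) => //; rewrite inE.
Qed.

End LocalRing.

(** * Descent for matrices *)

Section LinearForms.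
Variables (R S : comPzRingType) (phi : {rmorphism R -> S}) (T : finType).

(* p and q are the same linear form, with coefficients in R, evaluated on R and on S. *)
Definition linform (p : (T -> R) -> R) (q : (T -> S) -> S) : Prop :=
  exists L : T -> R, (forall x, p x = \sum_t x t * L t) /\
                     (forall y, q y = \sum_t y t * phi (L t)).

Definition linform_mx k l (P : (T -> R) -> 'M[R]_(k, l)) (Q : (T -> S) -> 'M[S]_(k, l)) :=
  forall a b, linform (fun x => P x a b) (fun y => Q y a b).

Lemma linform_var t : linform (fun x => x t) (fun y => y t).
Proof.
exists (fun t' => (t' == t)%:R); split=> x.
  by rewrite (bigD1 t) //= big1 ?eqxx ?mulr1 ?addr0 // => t' /negPf ->; rewrite mulr0.
rewrite (bigD1 t) //= big1 ?eqxx ?rmorph1 ?mulr1 ?addr0 // => t' /negPf ->.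
by rewrite rmorph0 mulr0.
Qed.

Lemma linform0 : linform (fun=> 0) (fun=> 0).
Proof. by exists (fun=> 0); split=> x; rewrite big1 // => t _; rewrite ?rmorph0 mulr0. Qed.

Lemma linformB p q p' q' : linform p q -> linform p' q' ->
  linform (fun x => p x - p' x) (fun y => q y - q' y).
Proof.
move=> [L [pE qE]] [L' [p'E q'E]]; exists (fun t => L t - L' t); split=> x.
  by rewrite pE p'E -sumrB; apply: eq_bigr => t _; rewrite mulrBr.
by rewrite qE q'E -sumrB; apply: eq_bigr => t _; rewrite rmorphB mulrBr.
Qed.

Lemma linform_lincomb (I : finType) (c : I -> R) p q : (forall i, linform (p i) (q i)) ->
  linform (fun x => \sum_i c i * p i x) (fun y => \sum_i phi (c i) * q i y).
Proof.
move=> /choice[L LE]; exists (fun t => \sum_i c i * L i t); split=> x.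
  under eq_bigr => i _ do rewrite (LE i).1 mulr_sumr.
  rewrite exchange_big; apply: eq_bigr => t _.
  by rewrite mulr_sumr; apply: eq_bigr => i _; rewrite mulrCA.
under eq_bigr => i _ do rewrite (LE i).2 mulr_sumr.
rewrite exchange_big; apply: eq_bigr => t _.
by rewrite rmorph_sum mulr_sumr; apply: eq_bigr => i _; rewrite rmorphM mulrCA.
Qed.

Lemma linform_mulmxl h k l (C : 'M[R]_(h, k)) (P : (T -> R) -> 'M[R]_(k, l)) Q :
  linform_mx P Q -> linform_mx (fun x => C *m P x) (fun y => map_mx phi C *m Q y).
Proof.
move=> PQ a b; have [L [pE qE]] := linform_lincomb (C a) (PQ^~ b).
exists L; split=> x; rewrite !mxE; first exact: pE.
by rewrite -qE; apply: eq_bigr => i _; rewrite mxE.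
Qed.

Lemma linform_mulmxr h k l (C : 'M[R]_(l, h)) (P : (T -> R) -> 'M[R]_(k, l)) Q :
  linform_mx P Q -> linform_mx (fun x => P x *m C) (fun y => Q y *m map_mx phi C).
Proof.
move=> PQ a b; have [L [pE qE]] := linform_lincomb (C^~ b) (PQ a).
exists L; split=> x; rewrite !mxE; [rewrite -pE|rewrite -qE];
  by apply: eq_bigr => i _; rewrite ?mxE mulrC.
Qed.

Lemma linform_mxB k l (P P' : (T -> R) -> 'M[R]_(k, l)) Q Q' :
  linform_mx P Q -> linform_mx P' Q' ->
  linform_mx (fun x => P x - P' x) (fun y => Q y - Q' y).
Proof.
move=> PQ PQ' a b; have [L [pE qE]] := linformB (PQ a b) (PQ' a b).
by exists L; split=> x; rewrite !mxE.
Qed.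

End LinearForms.

Section MatrixComplexes.
Variables (A : comPzRingType) (n : nat).
Implicit Types E D F G H : int -> 'M[A]_n.

(* E i and D i are the matrices of the identity and of the differential of a framed
   complex.  No condition F i = E i *m F i *m E' i is imposed on F: it represents
   the maps with matrices E i *m F i *m E' i. *)
Definition chain_mx E D E' D' F : Prop :=
  forall i, E i *m F i *m D' i = D i *m F (i + 1) *m E' (i + 1).

(* The endomorphism GF - (dH + Hd) of (E, D), extended by the identity to the
   ambient free module. *)
Definition homotopy_mx E D E' F G H (i : int) : 'M[A]_n :=
  E (i + 1) *m F (i + 1) *m E' (i + 1) *m G (i + 1) *m E (i + 1)
  - (E (i + 1) *m H i *m D i + D (i + 1) *m H (i + 1) *m E (i + 1))
  + (1%:M - E (i + 1)).

End MatrixComplexes.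

Section MatrixDescent.
Variables (R : comNzRingType) (S : comPzRingType) (phi : {rmorphism R -> S}).
Variables (n B : nat).

Local Notation K := ((2 * B).+1).
(** Indices of all unknown scalars: the pair of booleans selects one of the four families f, g, h,
    h', ['I_K] a degree between [- B] and [B], and the last pair a matrix entry. *)
Definition block_index : finType := ((bool * bool) * 'I_K * ('I_n * 'I_n))%type.

Definition bounded_mx (A : pzRingType) (F : int -> 'M[A]_n) :=
  forall i : int, (B < `|i|)%N -> F i = 0.

Definition deg_ord (i : int) : 'I_K := inord (absz (i + B%:Z)).
Definition ord_deg (k : 'I_K) : int := k%:Z - B%:Z.

Lemma deg_ordK i : (`|i| <= B)%N -> ord_deg (deg_ord i) = i.
Proof. by move=> iB; rewrite /ord_deg /deg_ord inordK; lia. Qed.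

Definition blocks (A : pzRingType) (t : block_index -> A) (q : bool * bool) (i : int) : 'M[A]_n :=
  if (`|i| <= B)%N then \matrix_(a, b) t (q, deg_ord i, (a, b)) else 0.

Lemma bounded_blocks (A : pzRingType) (t : block_index -> A) q : bounded_mx (blocks t q).
Proof. by move=> i Bi; rewrite /blocks leqNgt Bi. Qed.

Definition of_blocks (A : pzRingType) (F : bool * bool -> int -> 'M[A]_n) (t : block_index) : A :=
  F t.1.1 (ord_deg t.1.2) t.2.1 t.2.2.

Lemma of_blocksK (A : pzRingType) (F : bool * bool -> int -> 'M[A]_n) q :
  bounded_mx (F q) -> blocks (of_blocks F) q = F q.
Proof.
move=> Fq; apply/funext => i; rewrite /blocks; case: leqP => [iB|/Fq //].
by apply/matrixP => a b; rewrite mxE /of_blocks /= deg_ordK.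
Qed.

Lemma map_blocks (t : block_index -> R) q i :
  map_mx phi (blocks t q i) = blocks (phi \o t) q i.
Proof.
rewrite /blocks; case: ifP => _; last by rewrite map_mx0.
by apply/matrixP => a b; rewrite !mxE.
Qed.

Lemma linform_blocks q i :
  linform_mx phi (fun x : block_index -> R => blocks x q i) (fun y => blocks y q i).
Proof.
move=> a b; rewrite /blocks; case: (`|i| <= B)%N.
  by have [L [pE qE]] := linform_var phi (q, deg_ord i, (a, b)); exists L; split=> x; rewrite mxE.
by have [L [pE qE]] := linform0 phi block_index; exists L; split=> x; rewrite mxE.
Qed.

(** Beyond degree [B] both sides vanish; this makes the linear system finite. *)
Lemma chain_mx_bounded (A : comPzRingType) (E D E' D' F : int -> 'M[A]_n) :
  bounded_mx E -> bounded_mx D -> bounded_mx D' -> bounded_mx F ->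
  (forall k, E (ord_deg k) *m F (ord_deg k) *m D' (ord_deg k) =
             D (ord_deg k) *m F (ord_deg k + 1) *m E' (ord_deg k + 1)) ->
  chain_mx E D E' D' F.
Proof.
move=> E0 D0 D'0 F0 FP i; have [iB|Bi] := leqP `|i|%N B; first by rewrite -(deg_ordK iB).
by rewrite E0 // D0 // !mul0mx.
Qed.

Lemma map_homotopy_mx (E D E' F G H : int -> 'M[R]_n) i :
  map_mx phi (homotopy_mx E D E' F G H i) =
  homotopy_mx (map_mx phi \o E) (map_mx phi \o D) (map_mx phi \o E')
    (map_mx phi \o F) (map_mx phi \o G) (map_mx phi \o H) i.
Proof. by rewrite /homotopy_mx !(map_mxD, map_mxN, map_mxM, map_mx1). Qed.

Lemma homotopy_mx_bounded (A : comPzRingType) (E D E' F G H : int -> 'M[A]_n) i :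
  bounded_mx E -> bounded_mx D -> (B < absz (i + 1)%R)%N -> homotopy_mx E D E' F G H i = 1%:M.
Proof.
move=> E0 D0 iB; rewrite /homotopy_mx (E0 _ iB) (D0 _ iB).
by rewrite !(mul0mx, mulmx0, addr0, oppr0, add0r).
Qed.

Lemma ispolmx_homotopy (E D E' : int -> 'M[S]_n) (F G H : S -> int -> 'M[S]_n) i :
  (forall i, ispolmx (F^~ i)) -> (forall i, ispolmx (G^~ i)) -> (forall i, ispolmx (H^~ i)) ->
  ispolmx (fun z => homotopy_mx E D E' (F z) (G z) (H z) i).
Proof.
move=> FP GP HP; rewrite /homotopy_mx.
by repeat first [apply: ispolmx_cst | apply: ispolmxD | apply: ispolmxN | apply: ispolmxM
  | apply: FP | apply: GP | apply: HP].
Qed.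

Variables (m : set R).
Hypotheses (R_local : local_ring m) (k_infinite : infinite_set (cosets m)).
Hypothesis phi_fflat : faithfully_flat phi.
Variables E D E' D' : int -> 'M[R]_n.
Hypotheses (E0 : bounded_mx E) (D0 : bounded_mx D) (E'0 : bounded_mx E') (D'0 : bounded_mx D').

Local Notation "M ^phi" := (map_mx phi \o M) (at level 2).

Lemma matrix_descent (F G H H' : int -> 'M[S]_n) :
  bounded_mx F -> bounded_mx G -> bounded_mx H -> bounded_mx H' ->
  chain_mx E^phi D^phi E'^phi D'^phi F -> chain_mx E'^phi D'^phi E^phi D^phi G ->
  (forall i, homotopy_mx E^phi D^phi E'^phi F G H i = 1%:M) ->
  (forall i, homotopy_mx E'^phi D'^phi E^phi G F H' i = 1%:M) ->
  exists f g h h' : int -> 'M[R]_n,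
    [/\ chain_mx E D E' D' f, chain_mx E' D' E D g,
        forall i, exists b, \det (homotopy_mx E D E' f g h i) * b = 1 &
        forall i, exists b, \det (homotopy_mx E' D' E g f h' i) * b = 1].
Proof.
move=> F0 G0 H0 H'0 FP GP UP VP.
pose t := of_blocks (fun q => match q with
  | (false, false) => F | (false, true) => G | (true, false) => H | (true, true) => H' end).
pose qf := (false, false); pose qg := (false, true).
pose qh := (true, false); pose qh' := (true, true).
have tf : blocks t qf = F by apply: of_blocksK.
have tg : blocks t qg = G by apply: of_blocksK.
have th : blocks t qh = H by apply: of_blocksK.
have th' : blocks t qh' = H' by apply: of_blocksK.
(* One index per scalar equation: the boolean tells whether g or f is to be a chain map. The
   homotopies are subject to no equation. *)
pose J : finType := (bool * 'I_K * ('I_n * 'I_n))%type.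
pose chainR (j : J) (x : block_index -> R) : R :=
  (if j.1.1 then
    E' (ord_deg j.1.2) *m blocks x qg (ord_deg j.1.2) *m D (ord_deg j.1.2) -
    D' (ord_deg j.1.2) *m blocks x qg (ord_deg j.1.2 + 1) *m E (ord_deg j.1.2 + 1)
  else
    E (ord_deg j.1.2) *m blocks x qf (ord_deg j.1.2) *m D' (ord_deg j.1.2) -
    D (ord_deg j.1.2) *m blocks x qf (ord_deg j.1.2 + 1) *m E' (ord_deg j.1.2 + 1)) j.2.1 j.2.2.
pose chainS (j : J) (x : block_index -> S) : S :=
  (if j.1.1 then
    E'^phi (ord_deg j.1.2) *m blocks x qg (ord_deg j.1.2) *m D^phi (ord_deg j.1.2) -
    D'^phi (ord_deg j.1.2) *m blocks x qg (ord_deg j.1.2 + 1) *m E^phi (ord_deg j.1.2 + 1)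
  else
    E^phi (ord_deg j.1.2) *m blocks x qf (ord_deg j.1.2) *m D'^phi (ord_deg j.1.2) -
    D^phi (ord_deg j.1.2) *m blocks x qf (ord_deg j.1.2 + 1) *m E'^phi (ord_deg j.1.2 + 1))
  j.2.1 j.2.2.
have chain_lin j : linform phi (chainR j) (chainS j).
  by case: j => [[[] k] [a b]]; apply: linform_mxB; apply: linform_mulmxr;
    apply: linform_mulmxl; apply: linform_blocks.
(* The coefficients of the system are never written out; [linform] guarantees that they exist and
   agree over [R] and [S]. *)
have [L LE] := choice chain_lin.
have [j|k [c [s [cL tE]]]] :=
    @flat_solution_span R S phi block_index J (fun i j => L j i) t phi_fflat.1.
  rewrite -(LE j).2 /chainS tf tg; case: (j.1.1); first by rewrite GP subrr mxE.
  by rewrite FP subrr mxE.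
pose tR (x : 'I_k -> R) i := \sum_l x l * c l i.
pose tS (y : 'I_k -> S) i := \sum_l y l * phi (c l i).
have tSs : tS s = t by apply/funext => i; rewrite tE.
have chain0 x j : chainR j (tR x) = 0.
  rewrite (LE j).1; under eq_bigr => i _ do rewrite mulr_suml.
  rewrite exchange_big big1 // => l _; under eq_bigr => i _ do rewrite -mulrA.
  by rewrite -mulr_sumr cL mulr0.
have chain_g x : chain_mx E' D' E D (blocks (tR x) qg).
  apply: chain_mx_bounded => //; first exact: bounded_blocks.
  move=> d; apply/eqP; rewrite -subr_eq0; apply/eqP/matrixP => a b.
  by have := chain0 x (true, d, (a, b)); rewrite /chainR /= => ->; rewrite mxE.
have chain_f x : chain_mx E D E' D' (blocks (tR x) qf).
  apply: chain_mx_bounded => //; first exact: bounded_blocks.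
  move=> d; apply/eqP; rewrite -subr_eq0; apply/eqP/matrixP => a b.
  by have := chain0 x (false, d, (a, b)); rewrite /chainR /= => ->; rewrite mxE.
pose U x := homotopy_mx E D E' (blocks (tR x) qf) (blocks (tR x) qg) (blocks (tR x) qh).
pose V x := homotopy_mx E' D' E (blocks (tR x) qg) (blocks (tR x) qf) (blocks (tR x) qh').
pose US y := homotopy_mx E^phi D^phi E'^phi
  (blocks (tS y) qf) (blocks (tS y) qg) (blocks (tS y) qh).
pose VS y := homotopy_mx E'^phi D'^phi E^phi
  (blocks (tS y) qg) (blocks (tS y) qf) (blocks (tS y) qh').
(* [homotopy_mx] at [i] lives in degree [i + 1], hence the shift by 1 to cover the degrees from
   [- B] to [B]. *)
pose DR x := \prod_(d < K) (\det (U x (ord_deg d - 1)) * \det (V x (ord_deg d - 1))).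
pose DS y := \prod_(d < K) (\det (US y (ord_deg d - 1)) * \det (VS y (ord_deg d - 1))).
have mapblk x q : map_mx phi \o blocks (tR x) q = blocks (tS (fun l => phi (x l))) q.
  apply/funext => i /=; rewrite map_blocks; congr blocks; apply/funext => j.
  by rewrite /= rmorph_sum; apply: eq_bigr => l _; rewrite rmorphM.
have DRS x : DS (fun l => phi (x l)) = phi (DR x).
  rewrite rmorph_prod; apply: eq_bigr => d _.
  by rewrite rmorphM -!det_map_mx !map_homotopy_mx !mapblk.
have [[mid m1 _] _] := R_local.
have DSs : DS s = 1.
  rewrite /DS /US /VS tSs tf tg th th' big1 // => d _.
  by rewrite UP VP !det1 mulr1.
have DSP (g : S -> 'I_k -> S) : (forall l, ispol (g^~ l)) -> ispol (fun z => DS (g z)).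
  move=> gP.
  have blkP q i : ispolmx (fun z => blocks (tS (g z)) q i).
    move=> a b; rewrite /blocks; case: (`|i| <= B)%N; under eq_fun do rewrite mxE.
      by apply: ispol_sum => l; apply: ispolM => //; apply: ispol_cst.
    exact: ispol_cst.
  by apply: ispol_prod => d; apply: ispolM; apply: ispol_det; apply: ispolmx_homotopy.
have [r r_unit] := infinite_residues R_local k_infinite.
have [|x Dx] := @pol_specialize R S phi m r r_unit k DS s DSP.
  by rewrite DSs; apply: ext_ideal_proper.
have [|b Db] := local_ring_unit R_local (a := DR x).
  by move=> /ext_ideal_phi mDx; apply: Dx; rewrite DRS.
(* Each factor of an invertible product is invertible. *)
have UVunit i : (absz (i + 1)%R <= B)%N ->
    exists b, \det (U x i) * \det (V x i) * b = 1.
  move=> iB; move: Db; rewrite /DR (bigD1 (deg_ord (i + 1))) //= deg_ordK // addrK.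
  by rewrite -mulrA; set y := _ * b; exists y.
exists (blocks (tR x) qf), (blocks (tR x) qg), (blocks (tR x) qh), (blocks (tR x) qh').
split=> // i.
- have [iB|iB] := leqP (absz (i + 1)) B; last first.
    by exists 1; rewrite homotopy_mx_bounded // det1 mulr1.
  have [y yE] := UVunit i iB; by exists (\det (V x i) * y); rewrite mulrA.
- have [iB|iB] := leqP (absz (i + 1)) B; last first.
    by exists 1; rewrite homotopy_mx_bounded // det1 mulr1.
  have [y yE] := UVunit i iB; by exists (\det (U x i) * y); rewrite mulrCA mulrA.
Qed.

End MatrixDescent.

(** * From matrices back to complexes *)

Section HomotopyDefect.
Variables (A : comPzRingType) (X Y : complex A) (F : cmap X Y) (G : cmap Y X).
Variable h : forall i, {linear X (i + 1) -> X i}.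

Definition homotopy_defect i (x : X (i + 1)) : X (i + 1) :=
  G (i + 1) (F (i + 1) x) - (cdiff X i (h i x) + h (i + 1) (cdiff X (i + 1) x)).

Lemma homotopy_defect_diff i x :
  homotopy_defect (cdiff X (i + 1) x) = cdiff X (i + 1) (homotopy_defect x).
Proof.
rewrite /homotopy_defect !cfunP cdiffK linear0 addr0 [in RHS]linearB.
by rewrite [in RHS]linearD cdiffK add0r.
Qed.

Lemma homotopy_defectB i (x y : X (i + 1)) :
  homotopy_defect (x - y) = homotopy_defect x - homotopy_defect y.
Proof.
rewrite /homotopy_defect !linearB /=.
set a := cdiff X i _; set b := cdiff X i _; set c := h _ _; set d := h _ _.
set u := G _ _; set v := G _ _.
by rewrite [a - b + _]addrACA -(opprD b) (opprD (a + c)) [LHS]addrACA.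
Qed.

Definition defect_bij := forall i,
  (forall x : X (i + 1), homotopy_defect x = 0 -> x = 0) /\
  (forall y : X (i + 1), exists x, homotopy_defect x = y).

End HomotopyDefect.

(** The defects are bijective, commute with the differential and agree with [G F] and [F G] on
    cycles up to boundaries. The defect of [F G] gives surjectivity on cohomology, that of [G F]
    injectivity. *)
Lemma defect_bij_quasi_iso (A : comPzRingType) (X Y : complex A)
    (F : cmap X Y) (G : cmap Y X) h h' :
  defect_bij F G h -> defect_bij G F h' -> quasi_iso F.
Proof.
move=> Ubij Vbij i; split; last first.
  move=> y dy; have [y' y'E] := (Vbij i).2 y.
  have dy' : cdiff Y (i + 1) y' = 0.
    by apply: (Vbij (i + 1)).1; rewrite homotopy_defect_diff y'E.
  exists (G (i + 1) y'); first by rewrite /cpx_cycle -cfunP dy' linear0.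
  exists (h' i y'); rewrite -y'E /homotopy_defect dy' linear0 addr0.
  by rewrite opprB [RHS]addrC subrK.
(* The preimage of [x] lies one degree lower, and the defect is available there only if that degree
   has the form [i + 1]. *)
move: i; apply: forall_succ => i x dx [y yE].
have [x' x'E] := (Ubij i).2 (G (i + 1) y - h (i + 1) x).
exists x'; apply/esym/eqP; rewrite -subr_eq0; apply/eqP/(Ubij (i + 1)).1.
rewrite homotopy_defectB homotopy_defect_diff x'E linearB -cfunP yE.
by rewrite /homotopy_defect dx linear0 addr0 subrr.
Qed.

Section ComplexMatrices.
Variables (A : comPzRingType) (n : nat).

Definition frames (X : complex A) := forall i, frame n (X i).

Definition id_mx (X : complex A) (e : frames X) i := fmx (e i) (e i) id.
Definition diff_mx (X : complex A) (e : frames X) i := fmx (e i) (e (i + 1)) (cdiff X i).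

Section Maps.
Variables (X Y : complex A) (e : frames X) (e' : frames Y).

Lemma cmap_chain_mx (F : cmap X Y) :
  chain_mx (id_mx e) (diff_mx e) (id_mx e') (diff_mx e') (fun i => fmx (e i) (e' i) (F i)).
Proof.
move=> i; rewrite fmx_id_l -mulmxA fmx_id_r.
rewrite -(@fmx_comp _ _ _ _ _ (e i) (e' i) (e' (i + 1)) _ _ (cdiff Y i \o F i)) //.
by apply: fmx_comp => x; rewrite /= cfunP.
Qed.

Lemma homotopy_mx_eq1 (F : cmap X Y) (G : cmap Y X) (h : forall i, {linear X (i + 1) -> X i}) :
  (forall i x, G (i + 1) (F (i + 1) x) - x =
     cdiff X i (h i x) + h (i + 1) (cdiff X (i + 1) x)) ->
  forall i, homotopy_mx (id_mx e) (diff_mx e) (id_mx e')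
    (fun i => fmx (e i) (e' i) (F i)) (fun i => fmx (e' i) (e i) (G i))
    (fun i => fmx (e (i + 1)) (e i) (h i)) i = 1%:M.
Proof.
move=> hE i; rewrite /homotopy_mx !fmx_id_l !fmx_id_r -!mulmxA !fmx_id_r.
set a := e (i + 1); rewrite -(@fmx_comp _ _ _ _ _ a (e' (i + 1)) a _ _ (G (i + 1) \o F (i + 1))) //.
rewrite -(@fmx_comp _ _ _ _ _ a (e i) a _ _ (cdiff X i \o h i)) //.
rewrite -(@fmx_comp _ _ _ _ _ a (e (i + 1 + 1)) a _ _ (h (i + 1) \o cdiff X (i + 1))) //.
rewrite -(@fmxD _ _ _ _ _ _ _ _ (fun x => cdiff X i (h i x) + h (i + 1) (cdiff X (i + 1) x))) //.
rewrite -(@fmxB _ _ _ _ _ _ _ _ id) ?subrKC // => x.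
by rewrite -hE subKr.
Qed.

Lemma chain_mx_cmap (f : int -> 'M[A]_n) :
  chain_mx (id_mx e) (diff_mx e) (id_mx e') (diff_mx e') f ->
  exists F : cmap X Y, forall i x, F i x = mxf (e i) (e' i) (f i) x.
Proof.
move=> fP.
have FP i x : mxf (e (i + 1)) (e' (i + 1)) (f (i + 1)) (cdiff X i x) =
    cdiff Y i (mxf (e i) (e' i) (f i) x).
  apply: (@fcoord_inj _ _ _ (e' (i + 1))); rewrite /mxf fcoord_vec fmxE (fmx_coord (e i)).
  rewrite -(fcoord_id (e i) x) -!mulmxA; congr (_ *m _).
  by rewrite !mulmxA [RHS]fP -[id_mx e i *m _]/(fmx _ _ _ *m _) fmx_id_l.
by exists (@Cmap _ X Y (fun i => mxf (e i) (e' i) (f i)) FP).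
Qed.

End Maps.

Lemma fvec_id (M : lmodType A) (e : frame n M) r : fvec e (r *m fmx e e id) = fvec e r.
Proof. by rewrite -fcoord_vec fvecK. Qed.

(** [U] commutes with the idempotent [E], so its inverse preserves the summand too; there the term
    [1 - E] vanishes and [U] acts as the defect. *)
Lemma unit_homotopy_mx_defect_bij (X Y : complex A) (e : frames X) (e' : frames Y)
    (f g h : int -> 'M[A]_n) (F : cmap X Y) (G : cmap Y X) :
  (forall i x, F i x = mxf (e i) (e' i) (f i) x) ->
  (forall i x, G i x = mxf (e' i) (e i) (g i) x) ->
  (forall i, exists b, \det (homotopy_mx (id_mx e) (diff_mx e) (id_mx e') f g h i) * b = 1) ->
  defect_bij F G (fun i => mxf (e (i + 1)) (e i) (h i)).
Proof.
move=> FE GE Uunit i; have [b bE] := Uunit i.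
set U := homotopy_mx _ _ _ _ _ _ i in bE; set E := id_mx e (i + 1).
have EE : E *m E = E by rewrite /E /id_mx (fmx_id_l (e (i + 1)) (e (i + 1)) idfun).
have DE : diff_mx e i *m E = diff_mx e i by apply: fmx_id_r.
have ED : E *m diff_mx e (i + 1) = diff_mx e (i + 1) by apply: fmx_id_l.
have EU : E *m U = U *m E.
  rewrite /U /homotopy_mx -/E !(mulmxDr, mulmxDl, mulmxN, mulNmx, mulmx1, mul1mx) EE subrr.
  by rewrite !mulmxA EE ED -!mulmxA EE DE.
pose V := b *: \adj U.
have UV : U *m V = 1%:M by rewrite -scalemxAr mul_mx_adj scale_scalar_mx mulrC bE.
have VU : V *m U = 1%:M by rewrite -scalemxAl mul_adj_mx scale_scalar_mx mulrC bE.
have defectE x : homotopy_defect F G (fun i => mxf (e (i + 1)) (e i) (h i)) x =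
    fvec (e (i + 1)) (fcoord (e (i + 1)) x *m U).
  rewrite /homotopy_defect /= FE GE /mxf (fmx_coord (e (i + 1))) fcoord_vec.
  set c := fcoord _ _; have cE : c *m E = c by apply: fcoord_id.
  rewrite -[cdiff X i _](fvecK (e (i + 1))) fmxE -/(diff_mx e i) -/(diff_mx e (i + 1)).
  rewrite -/(id_mx e' (i + 1)) /U /homotopy_mx -/E.
  rewrite !(mulmxDr, mulmxN, mulmx1) !mulmxA !cE subrr addr0.
  by rewrite [RHS]linearB [in RHS]linearD /= /E !fvec_id.
have coord_vec x : fcoord (e (i + 1)) (fvec (e (i + 1)) (fcoord (e (i + 1)) x *m U)) =
    fcoord (e (i + 1)) x *m U.
  by rewrite fcoord_vec -/(id_mx e (i + 1)) -mulmxA -EU mulmxA fcoord_id.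
split=> [x|y].
  rewrite defectE => /(congr1 (fcoord (e (i + 1)))); rewrite coord_vec linear0 => cU.
  apply: (@fcoord_inj _ _ _ (e (i + 1))); rewrite linear0.
  by rewrite -[LHS]mulmx1 -UV mulmxA cU mul0mx.
exists (fvec (e (i + 1)) (fcoord (e (i + 1)) y *m V)).
rewrite defectE fcoord_vec -/(id_mx e (i + 1)) -/E -!mulmxA EU [V *m _]mulmxA VU mul1mx.
by rewrite fcoord_id fvecK.
Qed.

Lemma bounded_id_mx (X : complex A) (e : frames X) B :
  (forall i : int, (B < `|i|)%N -> forall x : X i, x = 0) -> bounded_mx B (id_mx e).
Proof. by move=> X0 i Bi; apply: (fmx_dom0 (e i) (e i) idfun); apply: X0. Qed.

Lemma bounded_diff_mx (X : complex A) (e : frames X) B :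
  (forall i : int, (B < `|i|)%N -> forall x : X i, x = 0) -> bounded_mx B (diff_mx e).
Proof. by move=> X0 i Bi; apply: fmx_dom0; apply: X0. Qed.

End ComplexMatrices.

Lemma strictly_perfect_frames (R : comPzRingType) (X : complex R) : strictly_perfect X ->
  exists B n0, (forall i : int, (B < `|i|)%N -> forall x : X i, x = 0) /\
    forall n, (n0 <= n)%N -> forall i, inhabited (frame n (X i)).
Proof.
move=> [[B X0] Xp].
have [n nP] := choice (fun i => fin_gen_projective_frame (Xp i).1 (Xp i).2).
exists B, (\max_(k < (2 * B).+1) n (ord_deg k)); split=> // n0 n0_ge i.
have [iB|Bi] := leqP `|i|%N B.
  rewrite -(deg_ordK iB); apply/nP/(leq_trans _ n0_ge).
  by rewrite (@leq_bigmax _ (fun k : 'I_(2 * B).+1 => n (ord_deg k))).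
(* Beyond degree [B] the module is zero, and zero maps frame it in any rank. *)
have K : cancel (\0 : {linear X i -> 'rV[R]_n0}) (\0 : {linear 'rV[R]_n0 -> X i}).
  by move=> x; rewrite (X0 i Bi x).
by constructor; exact: Frame K.
Qed.

Lemma base_change_zero (R S : comPzRingType) (phi : {rmorphism R -> S}) (M : lmodType R) :
  (forall x : M, x = 0) -> forall z : tensor phi M, z = 0.
Proof.
move=> M0 z; rewrite (tensor_sum_pure z) big1 // => p _.
by rewrite (M0 p.1) pure_tensor0l.
Qed.

Theorem theorem5p3 (R : comNzRingType) (m : set R)
  (R_noeth : noetherian R) (R_local : local_ring m)
  (k_infinite : infinite_set (cosets m))
  (S : comPzRingType) (phi : {rmorphism R -> S})
  (phi_fflat : faithfully_flat phi)
  (P Q : complex R)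
  (P_perf : strictly_perfect P) (Q_perf : strictly_perfect Q) :
  derived_iso (base_change phi P) (base_change phi Q) -> derived_iso P Q.
Proof.
have [BP [nP [P0 Pfr]]] := strictly_perfect_frames P_perf.
have [BQ [nQ [Q0 Qfr]]] := strictly_perfect_frames Q_perf.
pose B := maxn BP BQ; pose n := maxn nP nQ.
have {}P0 (i : int) : (B < `|i|)%N -> forall x : P i, x = 0.
  by rewrite gtn_max => /andP[/P0].
have {}Q0 (i : int) : (B < `|i|)%N -> forall x : Q i, x = 0.
  by rewrite gtn_max => /andP[_ /Q0].
have eP : frames n P by move=> i; apply: inhabited_witness; apply/Pfr/leq_maxl.
have eQ : frames n Q by move=> i; apply: inhabited_witness; apply/Qfr/leq_maxr.
pose eP' : frames n (base_change phi P) := fun i => base_change_frame phi (eP i).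
pose eQ' : frames n (base_change phi Q) := fun i => base_change_frame phi (eQ i).
have P'0 (i : int) (Bi : (B < `|i|)%N) := base_change_zero (phi := phi) (P0 i Bi).
have Q'0 (i : int) (Bi : (B < `|i|)%N) := base_change_zero (phi := phi) (Q0 i Bi).
have bP : bounded (base_change phi P) by exists B; apply: P'0.
have bQ : bounded (base_change phi Q) by exists B; apply: Q'0.
have fP : framed (base_change phi P) by exists n => i; constructor; apply: eP'.
have fQ : framed (base_change phi Q) by exists n => i; constructor; apply: eQ'.
move=> /(derived_iso_homotopy_equiv bP fP bQ fQ) [F [G [[h hE] [h' h'E]]]].
have idP : map_mx phi \o id_mx eP = id_mx eP'.
  by apply/funext => i; rewrite /= -base_change_fmx_id.
have idQ : map_mx phi \o id_mx eQ = id_mx eQ'.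
  by apply/funext => i; rewrite /= -base_change_fmx_id.
have dP : map_mx phi \o diff_mx eP = diff_mx eP'.
  by apply/funext => i; rewrite /= -base_change_fmx.
have dQ : map_mx phi \o diff_mx eQ = diff_mx eQ'.
  by apply/funext => i; rewrite /= -base_change_fmx.
(* The homotopy component indexed by [i] goes from degree [i + 1] to degree [i], so for [i] beyond
   [B] it is the target that is known to vanish. *)
have cod0 (M N : lmodType S) (e : frame n M) (e' : frame n N) (f : M -> N) :
    (forall y : N, y = 0) -> fmx e e' f = 0.
  by move=> N0; apply/matrixP => a b; rewrite !mxE (N0 (f _)) linear0 mxE.
pose F' i := fmx (eP' i) (eQ' i) (F i); pose G' i := fmx (eQ' i) (eP' i) (G i).
pose H i := fmx (eP' (i + 1)) (eP' i) (h i); pose H' i := fmx (eQ' (i + 1)) (eQ' i) (h' i).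
have F0 : bounded_mx B F' by move=> i Bi; apply/fmx_dom0/P'0.
have G0 : bounded_mx B G' by move=> i Bi; apply/fmx_dom0/Q'0.
have H0 : bounded_mx B H by move=> i Bi; apply/cod0/P'0.
have H'0 : bounded_mx B H' by move=> i Bi; apply/cod0/Q'0.
have [||||f [g [k [k' [fP' gP' Uf Ug]]]]] := matrix_descent R_local k_infinite phi_fflat
  (bounded_id_mx eP P0) (bounded_diff_mx eP P0)
  (bounded_id_mx eQ Q0) (bounded_diff_mx eQ Q0) F0 G0 H0 H'0.
- by rewrite idP idQ dP dQ; apply: cmap_chain_mx.
- by rewrite idP idQ dP dQ; apply: cmap_chain_mx.
- by rewrite idP idQ dP; apply: homotopy_mx_eq1.
- by rewrite idP idQ dQ; apply: homotopy_mx_eq1.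
have [f' f'E] := chain_mx_cmap fP'.
have [g' g'E] := chain_mx_cmap gP'.
have Ubij := unit_homotopy_mx_defect_bij f'E g'E Uf.
have Vbij := unit_homotopy_mx_defect_bij g'E f'E Ug.
exact: quasi_iso_derived_iso (defect_bij_quasi_iso Ubij Vbij).
Qed.
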